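(* Let $\mathfrak R$ and $\mathfrak S$ be complete, separated two-sided linear topological rings with countable bases of neighborhoods of zero, and let $\mathfrak f\colon\mathfrak R\to\mathfrak S$ be a left proflat continuous ring map. Assume that the forgetful functor $\mathfrak R\text{-}\mathsf{Contra}\to\mathfrak R\text{-}\mathsf{Mod}$ is fully faithful. Then the commutative square diagram of forgetful functors $$\begin{array}{ccc}\mathfrak S\text{-}\mathsf{Contra}&\longrightarrow&\mathfrak S\text{-}\mathsf{Mod}\\ {\scriptstyle\mathfrak f_\sharp}\downarrow&&\downarrow{\scriptstyle\mathfrak f_*}\\ \mathfrak R\text{-}\mathsf{Contra}&\longrightarrow&\mathfrak R\text{-}\mathsf{Mod}\end{array}$$ is a pseudopullback diagram, and both its horizontal functors are fully faithful.
   Context: All rings are associative and unital, and ring maps are unital ring homomorphisms. A topological ring is two-sided linear if open two-sided ideals form a base of neighborhoods of zero; it is complete and separated if the natural map to the projective limit of its quotients by all open subgroups is bijective. For a ring map $\mathfrak f\colon\mathfrak R\to\mathfrak S$ and $\mathfrak I\subset\mathfrak R$, $\mathfrak f(\mathfrak I)\mathfrak S$ is the right ideal generated by $\mathfrak f(\mathfrak I)$. The map $\mathfrak f$ is strongly right taut if those open two-sided ideals $\mathfrak I\subset\mathfrak R$ for which the closure of $\mathfrak f(\mathfrak I)\mathfrak S$ in $\mathfrak S$ is an open two-sided ideal of $\mathfrak S$ form a base of neighborhoods of zero in $\mathfrak R$. A strongly right taut continuous $\mathfrak f$ is left proflat if for every open two-sided ideal $\mathfrak I\subset\mathfrak R$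 such that the closure $\mathfrak J$ of $\mathfrak f(\mathfrak I)\mathfrak S$ is an open two-sided ideal in $\mathfrak S$, the ring $\mathfrak S/\mathfrak J$ is a flat left $\mathfrak R/\mathfrak I$-module. (So left proflat maps are by definition continuous and strongly right taut.) Contramodules. For a set $X$, let $\mathfrak R[[X]]$ be the set of all infinite formal linear combinations $\sum_{x\in X}r_xx$ whose coefficient families $(r_x\in\mathfrak R)_{x\in X}$ converge to zero (for every open subgroup $\mathfrak U\subset\mathfrak R$, $r_x\in\mathfrak U$ for all but finitely many $x$). A map $g\colon X\to Y$ induces $\mathfrak R[[g]]\colon\sum_x r_xx\mapsto\sum_y\bigl(\sum_{g(x)=y}r_x\bigr)y$, where infinite sums in $\mathfrak R$ are limits of finite partial sums. The functor $\mathfrak R[[-]]$ is a monad on sets with unit $\epsilon_X\colon x\mapsto 1\cdot x$ and multiplication $\phi_X\colon\mathfrak R[[\mathfrak R[[X]]]]\to\mathfrak R[[X]]$ given by opening parentheses. A left $\mathfrak R$-contramodule is a module (algebra) over this monad, i.e. a set $\mathfrak P$ with a map $\pi_{\mathfrak P}\colon\mathfrak R[[\mathfrak P]]\to\mathfrak P$ satisfying $\pi_{\mathfrak P}\epsilon_{\mathfrak P}=\mathrm{id}$ and $\pi_{\mathfrak P}\circ\mathfrak R[[\pi_{\mathfrak P}]]=\pi_{\mathfrak P}\circ\phi_{\mathfrak P}$. These form an abelian category $\mathfrak R\text{-}\mathsf{Contra}$. Restricting $\pi_{\mathfrak P}$ to finite linear combinations gives the forgetful functor $\mathfrak R\text{-}\mathsf{Contra}\to\mathfrak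 R\text{-}\mathsf{Mod}$ to left $\mathfrak R$-modules. Functors. A continuous $\mathfrak f$ induces maps $\mathfrak R[[X]]\to\mathfrak S[[X]]$; precomposing $\pi_{\mathfrak Q}\colon\mathfrak S[[\mathfrak Q]]\to\mathfrak Q$ with $\mathfrak R[[\mathfrak Q]]\to\mathfrak S[[\mathfrak Q]]$ defines the restriction of scalars $\mathfrak f_\sharp\colon\mathfrak S\text{-}\mathsf{Contra}\to\mathfrak R\text{-}\mathsf{Contra}$. $\mathfrak f_*$ is the usual restriction of scalars on left modules. Given functors $F\colon\mathsf A\to\mathsf C$ and $G\colon\mathsf B\to\mathsf C$, their pseudopullback $\mathsf P$ is the category of triples $(A,B,\phi)$ with $A\in\mathsf A$, $B\in\mathsf B$ and $\phi\colon F(A)\simeq G(B)$ an isomorphism in $\mathsf C$ (with the obvious morphisms). A square of functors $\mathsf D\to\mathsf A\xrightarrow{F}\mathsf C$, $\mathsf D\to\mathsf B\xrightarrow{G}\mathsf C$ commuting up to a fixed natural isomorphism is a pseudopullback diagram if the induced comparison functor $\mathsf D\to\mathsf P$ is an equivalence of categories. *)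

(* Defs.v *)
From HB Require Import structures.
From mathcomp Require Import all_boot all_algebra finmap.
From mathcomp Require Import boolp classical_sets functions cardinality.
From mathcomp Require Import filter topology tvs.
From mathcomp Require Import generic_quotient ring_quotient freeg.

Set Implicit Arguments.
Unset Strict Implicit.
Unset Printing Implicit Defensive.

Import GRing.Theory.

Local Open Scope classical_set_scope.
Local Open Scope quotient_scope.
Local Open Scope ring_scope.

Section Subgroups.
Variable V : zmodType.

Definition is_subgroup (A : set V) : Prop :=
  A 0 /\ forall x y, A x -> A y -> A (x - y).

Record subgroup := Subgroup {
  subgroup_set :> V -> Prop;
  subgroupP : is_subgroup subgroup_set }.

(* [ring_quotient] forms quotients by boolean predicates. *)
Definition subgroup_pred (A : subgroup) : V -> bool := fun x => `[< A x >].

Lemma subgroup_pred_closed (A : subgroup) : zmod_closed (subgroup_pred A).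
Proof.
case: A => A [A0 AB]; split; first exact/asboolP.
by move=> x y /asboolP Ax /asboolP Ay; apply/asboolP/AB.
Qed.

HB.instance Definition _ (A : subgroup) :=
  GRing.isZmodClosed.Build V (subgroup_pred A) (subgroup_pred_closed A).

Lemma subgroup0 (A : subgroup) : A 0.
Proof. by case: A => A []. Qed.

Lemma subgroupB (A : subgroup) x y : A x -> A y -> A (x - y).
Proof. by case: A => A [A0 AB]; apply: AB. Qed.

Lemma subgroupN (A : subgroup) x : A x -> A (- x).
Proof. by move=> Ax; rewrite -sub0r; apply: subgroupB => //; exact: subgroup0. Qed.

Lemma subgroupD (A : subgroup) x y : A x -> A y -> A (x + y).
Proof. by move=> Ax Ay; rewrite -[y]opprK; apply/subgroupB/subgroupN. Qed.

Definition quotz (A : subgroup) :=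
  Quotient.quot (GRing.ZmodClosed.clone V (subgroup_pred A) _).

HB.instance Definition _ (A : subgroup) := GRing.Zmodule.on (quotz A).

Definition cls (A : subgroup) (x : V) : quotz A := \pi_(quotz A) x.

Lemma cls_eq (A : subgroup) x y : cls A x = cls A y <-> A (x - y).
Proof.
rewrite /cls; split.
  by move=> /eqP; rewrite -Quotient.idealrBE => /asboolP.
by move=> Axy; apply/eqP; rewrite -Quotient.idealrBE; apply/asboolP.
Qed.

Lemma cls_surj (A : subgroup) (q : quotz A) : exists x, q = cls A x.
Proof. by exists (repr q); rewrite /cls reprK. Qed.

Lemma clsD A : {morph cls A : x y / x + y}.
Proof. exact: Quotient.pi_add. Qed.

Lemma clsB A : {morph cls A : x y / x - y}.
Proof.
by move=> x y; apply/(addIr (cls A y)); rewrite -clsD !subrK.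
Qed.

Lemma smallest_subgroup (G : set V) : is_subgroup (smallest is_subgroup G).
Proof.
split=> [A [[A0 _] _] //|x y Gx Gy A [[A0 AB] GA]].
have HA : is_subgroup A /\ G `<=` A by split; [split|].
by apply: AB; [exact: (Gx A)|exact: (Gy A)].
Qed.

Definition gen_subgroup (G : set V) := Subgroup (smallest_subgroup G).

End Subgroups.

Definition quot_map (V W : zmodType) (g : {additive V -> W})
    (A : subgroup V) (B : subgroup W) (gAB : forall x, A x -> B (g x)) :
    quotz A -> quotz B :=
  fun q => cls B (g (repr q)).

Lemma quot_mapE (V W : zmodType) (g : {additive V -> W}) (A : subgroup V)
    (B : subgroup W) (gAB : forall x, A x -> B (g x)) x :
  quot_map gAB (cls A x) = cls B (g x).
Proof.
rewrite /quot_map; apply/cls_eq; rewrite -raddfB; apply: gAB.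
by apply/cls_eq; rewrite {1}/cls reprK.
Qed.

Section Ideals.
Variable R : pzRingType.

Definition is_right_ideal (A : set R) : Prop :=
  is_subgroup A /\ forall a x, A x -> A (x * a).

Definition is_ideal (A : set R) : Prop :=
  [/\ is_subgroup A, forall a x, A x -> A (a * x) & forall a x, A x -> A (x * a)].

Record ideal := Ideal { ideal_set : set R; idealP : is_ideal ideal_set }.

Lemma ideal_subgroupP (I : ideal) : is_subgroup (ideal_set I).
Proof. by case: I => A []. Qed.

Definition ideal_subgroup (I : ideal) := Subgroup (ideal_subgroupP I).

Definition quotr (I : ideal) := quotz (ideal_subgroup I).

End Ideals.

Coercion ideal_subgroup : ideal >-> subgroup.

Section QuotientRing.
Variables (R : pzRingType) (I : ideal R).

HB.instance Definition _ := GRing.Zmodule.on (quotr I).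

Definition quotr_one : quotr I := cls I 1.
Definition quotr_mul (p q : quotr I) : quotr I := cls I (repr p * repr q).

Lemma cls_mul x y : quotr_mul (cls I x) (cls I y) = cls I (x * y).
Proof.
have [_ Il Ir] := idealP I.
apply/cls_eq; set x' := repr _; set y' := repr _.
have Hx : I (x' - x) by apply/cls_eq; rewrite {1}/cls reprK.
have Hy : I (y' - y) by apply/cls_eq; rewrite {1}/cls reprK.
have -> : x' * y' - x * y = x' * (y' - y) + (x' - x) * y.
  by rewrite mulrBr mulrBl addrA subrK.
by apply: subgroupD; [apply: Il|apply: Ir].
Qed.

Lemma quotr_mulA : associative quotr_mul.
Proof.
move=> p q r; have [x ->] := cls_surj p; have [y ->] := cls_surj q.
by have [z ->] := cls_surj r; rewrite !cls_mul mulrA.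
Qed.

Lemma quotr_mul1 : left_id quotr_one quotr_mul.
Proof. by move=> p; have [x ->] := cls_surj p; rewrite cls_mul mul1r. Qed.

Lemma quotr_mulr1 : right_id quotr_one quotr_mul.
Proof. by move=> p; have [x ->] := cls_surj p; rewrite cls_mul mulr1. Qed.

Lemma quotr_mulDl : left_distributive quotr_mul +%R.
Proof.
move=> p q r; have [x ->] := cls_surj p; have [y ->] := cls_surj q.
by have [z ->] := cls_surj r; rewrite -clsD !cls_mul mulrDl clsD.
Qed.

Lemma quotr_mulDr : right_distributive quotr_mul +%R.
Proof.
move=> p q r; have [x ->] := cls_surj p; have [y ->] := cls_surj q.
by have [z ->] := cls_surj r; rewrite -clsD !cls_mul mulrDr clsD.
Qed.

HB.instance Definition _ := GRing.Zmodule_isPzRing.Build (quotr I)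
  quotr_mulA quotr_mul1 quotr_mulr1 quotr_mulDl quotr_mulDr.

End QuotientRing.

Section QuotientRingMorphism.
Variables (R S : pzRingType) (f : {rmorphism R -> S}).
Variables (I : ideal R) (J : ideal S).

Definition quotr_map (fIJ : forall x, I x -> J (f x)) : quotr I -> quotr J :=
  quot_map fIJ.

Variable fIJ : forall x, I x -> J (f x).

Lemma quotr_map_is_zmod_morphism : zmod_morphism (quotr_map fIJ).
Proof.
move=> p q; have [x ->] := cls_surj p; have [y ->] := cls_surj q.
have BE K (L : ideal K) (u v : K) : (cls L u : quotr L) - cls L v = cls L (u - v).
  by rewrite [RHS]clsB.
by rewrite BE /quotr_map !quot_mapE raddfB BE.
Qed.

Lemma quotr_map_is_monoid_morphism : monoid_morphism (quotr_map fIJ).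
Proof.
split; first by rewrite /quotr_map quot_mapE /= rmorph1.
move=> p q; have [x ->] := cls_surj p; have [y ->] := cls_surj q.
have mE K (L : ideal K) (u v : K) : (cls L u : quotr L) * cls L v = cls L (u * v).
  exact: cls_mul.
by rewrite mE /quotr_map !quot_mapE /= rmorphM mE.
Qed.

HB.instance Definition _ := GRing.isZmodMorphism.Build (quotr I) (quotr J)
  (quotr_map fIJ) quotr_map_is_zmod_morphism.
HB.instance Definition _ := GRing.isMonoidMorphism.Build (quotr I) (quotr J)
  (quotr_map fIJ) quotr_map_is_monoid_morphism.

End QuotientRingMorphism.

Definition restr_scalars (R S : pzRingType) (f : {rmorphism R -> S})
  (M : lmodType S) : Type := M.

Section RestrictScalars.
Variables (R S : pzRingType) (f : {rmorphism R -> S}) (M : lmodType S).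

HB.instance Definition _ := GRing.Zmodule.copy (restr_scalars f M) M.

Definition restr_scale (r : R) (x : restr_scalars f M) : restr_scalars f M :=
  f r *: (x : M).

Lemma restr_scaleA a b x : restr_scale a (restr_scale b x) = restr_scale (a * b) x.
Proof. by rewrite /restr_scale scalerA rmorphM. Qed.

Lemma restr_scale1 : left_id 1 restr_scale.
Proof. by move=> x; rewrite /restr_scale rmorph1 scale1r. Qed.

Lemma restr_scaleDr : right_distributive restr_scale +%R.
Proof. by move=> a x y; exact: scalerDr. Qed.

Lemma restr_scaleDl x : {morph restr_scale^~ x : a b / a + b}.
Proof. by move=> a b; rewrite /restr_scale rmorphD scalerDl. Qed.

HB.instance Definition _ := GRing.Zmodule_isLmodule.Build R (restr_scalars f M)
  restr_scaleA restr_scale1 restr_scaleDr restr_scaleDl.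

End RestrictScalars.

(* Right modules over [R] are left modules over the opposite ring [R^c]. *)
Section TensorProduct.
Variables (R : pzRingType) (F : lmodType R).

Inductive tensor_rel (M : lmodType R^c) : set {freeg (M * F) / int} :=
| TensorAddl m m' x :
    tensor_rel (<< (m + m', x) >> - << (m, x) >> - << (m', x) >>)
| TensorAddr m x x' :
    tensor_rel (<< (m, x + x') >> - << (m, x) >> - << (m, x') >>)
| TensorScale (m : M) (r : R) x :
    tensor_rel (<< ((r : R^c) *: m, x) >> - << (m, r *: x) >>).

Definition tensor (M : lmodType R^c) := quotz (gen_subgroup (@tensor_rel M)).

Variables (M N : lmodType R^c) (i : {linear M -> N}).

Definition freeg_map : {freeg (M * F) / int} -> {freeg (N * F) / int} :=
  fglift (fun p => << (i p.1, p.2) >>).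

HB.instance Definition _ := GRing.isZmodMorphism.Build _ _ (freeg_map)
  (lift_is_additive (fun p : M * F => << (i p.1, p.2) >> : {freeg (N * F) / int})).

Lemma freeg_mapU m x : freeg_map << (m, x) >> = << (i m, x) >>.
Proof. by rewrite /freeg_map liftU scale1r. Qed.

Lemma freeg_map_rel z : gen_subgroup (@tensor_rel M) z ->
  gen_subgroup (@tensor_rel N) (freeg_map z).
Proof.
move=> Mz A [[A0 AB] relA].
apply: (Mz (freeg_map @^-1` A)); split.
  split; first by rewrite /= raddf0.
  by move=> x y /= Ax Ay; rewrite raddfB; apply: AB.
move=> _ [m m' x|m x x'|m r x] /=; rewrite !raddfB /= !freeg_mapU.
- by rewrite raddfD; apply/relA/TensorAddl.
- exact/relA/TensorAddr.
- by rewrite linearZ; apply/relA/TensorScale.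
Qed.

Definition tensor_map : tensor M -> tensor N := quot_map freeg_map_rel.

End TensorProduct.

Definition flat (R : pzRingType) (F : lmodType R) : Prop :=
  forall (M N : lmodType R^c) (i : {linear M -> N}),
    injective i -> injective (@tensor_map R F M N i).

HB.mixin Record TopologicalZmodule_isTopologicalRing R
    & TopologicalZmodule R & GRing.PzRing R := {
  mul_continuous : continuous (fun x : R * R => x.1 * x.2) }.

#[short(type="topologicalRingType")]
HB.structure Definition TopologicalRing :=
  {R of TopologicalZmodule R & GRing.PzRing R
      & TopologicalZmodule_isTopologicalRing R}.

Definition is_nbhs_base0 (V : topologicalZmodType) (B : set (set V)) : Prop :=
  (forall U, B U -> nbhs (0 : V) U) /\
  (forall N, nbhs (0 : V) N -> exists2 U, B U & U `<=` N).

Definition countable_nbhs_base0 (V : topologicalZmodType) : Prop :=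
  exists2 B : set (set V), countable B & is_nbhs_base0 B.

Definition two_sided_linear (R : topologicalRingType) : Prop :=
  is_nbhs_base0 [set I : set R | open I /\ is_ideal I].

Record open_subgroup (V : topologicalZmodType) := OpenSubgroup {
  open_subgroup_val :> subgroup V;
  open_subgroupP : open (subgroup_set open_subgroup_val) }.

(* The projective limit of the quotients of [V] by all its open subgroups. *)
Record projlim (V : topologicalZmodType) := Projlim {
  projlim_val : forall U : open_subgroup V, quotz U;
  projlimP : forall (U W : open_subgroup V) (UW : forall x, U x -> W x),
    quot_map (g := idfun) UW (projlim_val U) = projlim_val W }.

Lemma projlim_ext (V : topologicalZmodType) (p q : projlim V) :
  (forall U, projlim_val p U = projlim_val q U) -> p = q.
Proof.
case: p q => [p pP] [q qP] /= pq.
have {}pq : p = q by apply: functional_extensionality_dep.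
by subst q; congr Projlim; exact: Prop_irrelevance.
Qed.

Section ToProjlim.
Variable V : topologicalZmodType.

Lemma to_projlim_subproof (x : V) (U W : open_subgroup V)
    (UW : forall x, U x -> W x) :
  quot_map (g := idfun) UW (cls U x) = cls W x.
Proof. by rewrite quot_mapE. Qed.

Definition to_projlim (x : V) : projlim V :=
  Projlim (@to_projlim_subproof x).

End ToProjlim.

Definition complete_separated (V : topologicalZmodType) : Prop :=
  bijective (@to_projlim V).

HB.mixin Record isCompleteLinearRing R & TopologicalRing R := {
  two_sided_linearP : two_sided_linear R;
  complete_separatedP : complete_separated R }.

#[short(type="clinRingType")]
HB.structure Definition CompleteLinearRing :=
  {R of TopologicalRing R & isCompleteLinearRing R}.

Definition finite_subsets (X : choiceType) : set_system {fset X} :=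
  filter_from setT (fun A => [set B | (A `<=` B)%fset]).
Arguments finite_subsets X : clear implicits.

Definition sums_to (V : topologicalZmodType) (X : choiceType) (r : X -> V)
    (s : V) : Prop :=
  (fun A : {fset X} => \sum_(x <- A) r x) @ finite_subsets X --> s.

(* The value of a convergent sum; [0] if the sum diverges. *)
Definition infsum (V : topologicalZmodType) (X : choiceType) (r : X -> V) : V :=
  xget 0 [set s | sums_to r s].

Definition null_family (V : topologicalZmodType) (X : choiceType)
    (r : X -> V) : Prop :=
  forall U : open_subgroup V, finite_set [set x | ~ U (r x)].

Section SumTheory.

Lemma nbhs_subl (V : topologicalZmodType) (a s : V) (N : set V) :
  nbhs (a - s) N -> nbhs s [set x | N (a - x)].
Proof.
move=> N0.
have : continuous_at s (fun x : V => a - x).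
  apply: (@continuous_comp _ _ _ (fun x : V => (a, x))
    (fun p : V * V => p.1 - p.2)); last exact: sub_continuous.
  by apply: cvg_pair => /=; [exact: cvg_cst|exact: cvg_id].
by apply.
Qed.

Lemma open_subgroup_nbhs (V : topologicalZmodType) (U : open_subgroup V) :
  nbhs (0 : V) (subgroup_set U).
Proof.
apply: open_nbhs_nbhs; split; first exact: open_subgroupP.
exact: subgroup0.
Qed.

Variable R : clinRingType.

Lemma small_ideal N : nbhs (0 : R) N ->
  exists2 I : open_subgroup R, is_ideal (subgroup_set I) & subgroup_set I `<=` N.
Proof.
move=> N0; have [_ /(_ N N0)[I [oI iI] IN]] := @two_sided_linearP R.
have sI : is_subgroup I by case: iI.
by exists (@OpenSubgroup R (Subgroup sI) oI).
Qed.

Lemma separated (s t : R) :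
  (forall U : open_subgroup R, U (s - t)) -> s = t.
Proof.
move=> st; apply: (bij_inj (@complete_separatedP R)).
by apply: projlim_ext => U /=; apply/cls_eq.
Qed.

Section Family.
Variable X : choiceType.
Implicit Types (r : X -> R) (A B : {fset X}) (U : open_subgroup R).

Lemma sum_mem U A (F : X -> R) : (forall x, x \in A -> U (F x)) ->
  U (\sum_(x <- A) F x).
Proof.
move=> UF; rewrite big_seq; apply: big_ind => //; first exact: subgroup0.
by move=> *; exact: subgroupD.
Qed.

Lemma sum_tail U A B r : (forall x, x \notin A -> U (r x)) -> (A `<=` B)%fset ->
  U (\sum_(x <- B) r x - \sum_(x <- A) r x).
Proof.
move=> Ur AB; rewrite (bigID (mem A)) /=.
have -> : \sum_(x <- B | x \in A) r x = \sum_(x <- A) r x.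
  rewrite -big_filter; apply: perm_big; apply: uniq_perm => //.
    by rewrite filter_uniq.
  move=> x; rewrite mem_filter; case xA: (x \in A) => //=.
  by rewrite (fsubsetP AB).
rewrite addrAC subrr add0r; apply: big_ind => //; first exact: subgroup0.
by move=> *; exact: subgroupD.
Qed.

Lemma null_fset r U : null_family r ->
  exists A, forall x, x \notin A -> U (r x).
Proof.
move=> /(_ U) /finite_fsetP[A EA]; exists A => x; apply: contraNP => nU.
by have : [set x | ~ U (r x)] x by []; rewrite EA.
Qed.

Lemma fset_null r : (forall U, exists A, forall x, x \notin A -> U (r x)) ->
  null_family r.
Proof.
move=> H U; have [A AU] := H U.
apply: (sub_finite_set (B := [set` A])); last exact: finite_fset.
by move=> x /= nU; apply: contrapT => /negP xA; exact/nU/AU.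
Qed.

Lemma sums_toP r s : sums_to r s <->
  forall U, exists A, forall B, (A `<=` B)%fset -> U (s - \sum_(x <- B) r x).
Proof.
split=> [rs U|H N sN].
  have sU : nbhs (s - s) (subgroup_set U).
    by rewrite subrr; exact: open_subgroup_nbhs.
  have [A _ AU] := rs _ (nbhs_subl sU).
  by exists A => B AB; exact: (AU B AB).
have N0 : nbhs (0 : R) [set x | N (s - x)] by apply: nbhs_subl; rewrite subr0.
have [I _ IN] := small_ideal N0; have [A AI] := H I.
exists A => // B /= AB; have /= := IN _ (AI B AB).
by rewrite opprB addrC subrK.
Qed.

Lemma null_summable r : null_family r -> exists s, sums_to r s.
Proof.
move=> nr.
pose a U := sval (cid (null_fset U nr)).
have aP U : forall x, x \notin a U -> U (r x) by rewrite /a; case: cid.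
pose c U : quotz U := cls U (\sum_(x <- a U) r x).
have cP (U W : open_subgroup R) (UW : forall x, U x -> W x) :
    quot_map (g := idfun) UW (c U) = c W.
  rewrite /c quot_mapE; apply/cls_eq => /=.
  pose B := (a U `|` a W)%fset.
  have -> : \sum_(x <- a U) r x - \sum_(x <- a W) r x =
    (\sum_(x <- B) r x - \sum_(x <- a W) r x) -
    (\sum_(x <- B) r x - \sum_(x <- a U) r x).
    by rewrite opprB [RHS]addrC addrA subrK.
  apply: subgroupB; first by apply: sum_tail; [exact: aP|exact: fsubsetUr].
  by apply: UW; apply: sum_tail; [exact: aP|exact: fsubsetUl].
have [g _ gK] := @complete_separatedP R.
exists (g (Projlim cP)); apply/sums_toP => U; exists (a U) => B AB.
set s := g _; have : cls U s = c U.
  by rewrite -[LHS]/(projlim_val (to_projlim s) U) /s gK.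
move/cls_eq => Us.
have -> : s - \sum_(x <- B) r x = (s - \sum_(x <- a U) r x) -
    (\sum_(x <- B) r x - \sum_(x <- a U) r x).
  by rewrite opprB addrA subrK.
by apply: subgroupB => //; apply: sum_tail => //; exact: aP.
Qed.

Lemma infsum_approx r U A : null_family r ->
  (forall x, x \notin A -> U (r x)) -> U (infsum r - \sum_(x <- A) r x).
Proof.
move=> /null_summable[s0 rs0] AU.
have : sums_to r (infsum r) by exact: (xgetPex 0 (ex_intro _ s0 rs0)).
move=> /sums_toP /(_ U)[B BU].
have := BU (A `|` B)%fset (fsubsetUr _ _) => H1.
have := sum_tail AU (fsubsetUl A B) => H2.
by have := subgroupD H1 H2; rewrite addrA subrK.
Qed.

Lemma infsum_eq r s : null_family r ->
  (forall U, exists2 A : {fset X}, (forall x, x \notin A -> U (r x)) &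
                        U (s - \sum_(x <- A) r x)) ->
  infsum r = s.
Proof.
move=> nr H; apply: separated => U; have [A AU sU] := H U.
have := infsum_approx nr AU => rU.
by have := subgroupB rU sU; rewrite opprB addrA subrK.
Qed.

Lemma infsum_fin r A : (forall x, x \notin A -> r x = 0) ->
  infsum r = \sum_(x <- A) r x.
Proof.
move=> r0; apply: infsum_eq => [|U].
  by apply: fset_null => U; exists A => x /r0 ->; exact: subgroup0.
exists A; first by move=> x /r0 ->; exact: subgroup0.
by rewrite subrr; exact: subgroup0.
Qed.

Lemma infsum1 x0 (r : X -> R) : (forall x, x != x0 -> r x = 0) ->
  infsum r = r x0.
Proof.
move=> r0; rewrite (@infsum_fin _ [fset x0]%fset) ?big_seq_fset1 //.
by move=> x; rewrite inE => /r0.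
Qed.

Lemma null_single x0 (a : R) : null_family (fun x : X => if x == x0 then a else 0).
Proof.
apply: fset_null => U; exists [fset x0]%fset => x; rewrite inE => /negPf ->.
exact: subgroup0.
Qed.

Lemma null0 : null_family (fun _ : X => 0 : R).
Proof. by apply: fset_null => U; exists fset0 => x _; exact: subgroup0. Qed.

Lemma nullD r r' : null_family r -> null_family r' ->
  null_family (fun x => r x + r' x).
Proof.
move=> nr nr'; apply: fset_null => U.
have [A AU] := null_fset U nr; have [B BU] := null_fset U nr'.
exists (A `|` B)%fset => x; rewrite inE negb_or => /andP[xA xB].
by apply: subgroupD; [exact: AU|exact: BU].
Qed.

Lemma nullMl a r : null_family r -> null_family (fun x => a * r x).
Proof.
move=> nr; apply: fset_null => U.
have [I [_ Il _] IU] := small_ideal (open_subgroup_nbhs U).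
by have [A AI] := null_fset I nr; exists A => x /AI xI; apply/IU/Il.
Qed.

Lemma nullMr r (b : X -> R) : null_family r -> null_family (fun x => r x * b x).
Proof.
move=> nr; apply: fset_null => U.
have [I [_ _ Ir] IU] := small_ideal (open_subgroup_nbhs U).
by have [A AI] := null_fset I nr; exists A => x /AI xI; apply/IU/Ir.
Qed.

Lemma null_if r (P : pred X) : null_family r ->
  null_family (fun x => if P x then r x else 0).
Proof.
move=> nr; apply: fset_null => U; have [A AU] := null_fset U nr.
by exists A => x /AU; case: ifP => // _ _; exact: subgroup0.
Qed.

Lemma infsumD r r' : null_family r -> null_family r' ->
  infsum (fun x => r x + r' x) = infsum r + infsum r'.
Proof.
move=> nr nr'; apply: infsum_eq; first exact: nullD.
move=> U; have [A AU] := null_fset U nr; have [B BU] := null_fset U nr'.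
have AU' x : x \notin (A `|` B)%fset -> U (r x).
  by rewrite inE negb_or => /andP[/AU].
have BU' x : x \notin (A `|` B)%fset -> U (r' x).
  by rewrite inE negb_or => /andP[_ /BU].
exists (A `|` B)%fset => [x xAB|]; first by apply: subgroupD; auto.
rewrite big_split /= opprD addrACA.
by apply: subgroupD; exact: infsum_approx.
Qed.

Lemma infsumMl a r : null_family r ->
  infsum (fun x => a * r x) = a * infsum r.
Proof.
move=> nr; apply: infsum_eq; first exact: nullMl.
move=> U; have [I [_ Il _] IU] := small_ideal (open_subgroup_nbhs U).
have [A AI] := null_fset I nr; exists A => [x /AI xI|]; first exact/IU/Il.
by rewrite -mulr_sumr -mulrBr; apply/IU/Il/infsum_approx.
Qed.

Lemma infsumMr a r : null_family r ->
  infsum (fun x => r x * a) = infsum r * a.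
Proof.
move=> nr; apply: infsum_eq; first exact: (nullMr (fun=> a)).
move=> U; have [I [_ _ Ir] IU] := small_ideal (open_subgroup_nbhs U).
have [A AI] := null_fset I nr; exists A => [x /AI xI|]; first exact/IU/Ir.
by rewrite -mulr_suml -mulrBl; apply/IU/Ir/infsum_approx.
Qed.

Lemma infsum_mem U r : null_family r -> (forall x, U (r x)) -> U (infsum r).
Proof.
move=> nr Ur; have := @infsum_approx r U fset0 nr (fun x _ => Ur x).
by rewrite big_seq_fset0 subr0.
Qed.

End Family.

Lemma null_fibre (X Y : choiceType) (g : X -> Y) (r : X -> R) : null_family r ->
  null_family (fun y => infsum (fun x => if g x == y then r x else 0)).
Proof.
move=> nr; apply: fset_null => U; have [A AU] := null_fset U nr.
exists (g @` A)%fset => y yA; apply: infsum_mem; first exact: null_if.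
move=> x; case: eqP => [gxy|_]; last exact: subgroup0.
by apply: AU; apply: contra yA => xA; rewrite -gxy in_imfset.
Qed.

Lemma infsum_fibre (X Y : choiceType) (g : X -> Y) (r : X -> R) :
  null_family r ->
  infsum (fun y => infsum (fun x => if g x == y then r x else 0)) = infsum r.
Proof.
move=> nr; apply: infsum_eq; first exact: null_fibre.
move=> U; have [A AU] := null_fset U nr.
exists (g @` A)%fset => [y yA|].
  apply: infsum_mem; first exact: null_if.
  move=> x; case: eqP => [gxy|_]; last exact: subgroup0.
  by apply: AU; apply: contra yA => xA; rewrite -gxy in_imfset.
pose v y := infsum (fun x => if g x == y then r x else 0).
pose w y := \sum_(x <- A) (if g x == y then r x else 0).
have Ew : \sum_(y <- (g @` A)%fset) w y = \sum_(x <- A) r x.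
  rewrite /w exchange_big /= [LHS]big_seq [RHS]big_seq.
  apply: eq_bigr => x xA.
  rewrite (bigD1_seq (g x)) ?eqxx //=; last exact: in_imfset.
  by rewrite big1 ?addr0 // => y /negPf; rewrite eq_sym => ->.
have -> : infsum r - \sum_(y <- (g @` A)%fset) v y =
   (infsum r - \sum_(x <- A) r x) - \sum_(y <- (g @` A)%fset) (v y - w y).
  by rewrite sumrB Ew opprB addrA subrK.
apply: subgroupB; first exact: infsum_approx.
apply: sum_mem => y _; apply: infsum_approx; first exact: null_if.
by move=> x /AU; case: ifP => // _ _; exact: subgroup0.
Qed.

End SumTheory.

Section SumMorphism.
Variables (R S : clinRingType) (f : {rmorphism R -> S}).
Hypothesis fcont : continuous f.

Lemma preim_subgroupP (U : subgroup S) : is_subgroup [set x | U (f x)].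
Proof.
split; first by rewrite /= rmorph0; exact: subgroup0.
by move=> x y /= Ux Uy; rewrite rmorphB; exact: subgroupB.
Qed.

Lemma preim_open (U : open_subgroup S) : open [set x | U (f x)].
Proof. by have /continuousP := fcont; apply; exact: open_subgroupP. Qed.

Definition preim_open_subgroup (U : open_subgroup S) : open_subgroup R :=
  @OpenSubgroup R (Subgroup (preim_subgroupP U)) (preim_open U).

Lemma null_morph (X : choiceType) (r : X -> R) : null_family r ->
  null_family (fun x => f (r x)).
Proof. by move=> nr U; exact: (nr (preim_open_subgroup U)). Qed.

Lemma infsum_morph (X : choiceType) (r : X -> R) : null_family r ->
  infsum (fun x => f (r x)) = f (infsum r).
Proof.
move=> nr; apply: infsum_eq; first exact: null_morph.
move=> U; have [A AU] := null_fset (preim_open_subgroup U) nr.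
exists A => //; rewrite -rmorph_sum -rmorphB.
exact: (infsum_approx nr AU).
Qed.

End SumMorphism.

(* [fcomb R X] is R[[X]].  It is endowed with a (classical) [choiceType]
   structure because sets are represented by [choiceType]s throughout, in
   accordance with the carriers of [lmodType]. *)
Record fcomb (R : topologicalZmodType) (X : choiceType) := Fcomb {
  coef :> X -> R;
  coefP : null_family coef }.

HB.instance Definition _ R X := gen_eqMixin (fcomb R X).
HB.instance Definition _ R X := gen_choiceMixin (fcomb R X).

Lemma fcomb_ext (R : topologicalZmodType) (X : choiceType) (c d : fcomb R X) :
  c =1 d -> c = d.
Proof.
case: c d => [c cP] [d dP] /= cd.
have {}cd : c = d by apply: functional_extensionality_dep.
by subst d; congr Fcomb; exact: Prop_irrelevance.
Qed.

Section Monad.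
Variable R : clinRingType.

Definition fcomb_single (X : choiceType) (a : R) (x : X) : fcomb R X :=
  Fcomb (@null_single R X x a).

Definition fcomb_unit (X : choiceType) (x : X) : fcomb R X := fcomb_single 1 x.

Definition fcomb_map (X Y : choiceType) (g : X -> Y) (c : fcomb R X) :
    fcomb R Y :=
  Fcomb (null_fibre g (coefP c)).

(* Opening parentheses: the coefficient of [x] in the expansion of
   [sum_a c_a a] is [sum_a c_a a_x]. *)
Lemma fcomb_join_subproof (X : choiceType) (c : fcomb R (fcomb R X)) :
  null_family (fun x => infsum (fun a : fcomb R X => c a * a x)).
Proof.
apply: fset_null => U.
have [I [_ Il Ir] IU] := small_ideal (open_subgroup_nbhs U).
have [A AI] := null_fset I (coefP c).
pose B (a : fcomb R X) := sval (cid (null_fset I (coefP a))).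
have BP a x : x \notin B a -> I (a x) by rewrite /B; case: cid => ? /= H /H.
exists (\bigcup_(a <- A) B a)%fset => x xB; apply: IU.
apply: infsum_mem => [|a]; first exact: nullMr (coefP c).
have [aA|/AI] := boolP (a \in A); last exact: Ir.
apply/Il/BP; apply: contra xB => xBa.
by apply/bigfcupP; exists a; rewrite ?aA.
Qed.

Definition fcomb_join (X : choiceType) (c : fcomb R (fcomb R X)) : fcomb R X :=
  Fcomb (fcomb_join_subproof c).

Definition fcomb_zero (X : choiceType) : fcomb R X := Fcomb (@null0 R X).

Definition fcomb_add (X : choiceType) (c d : fcomb R X) : fcomb R X :=
  Fcomb (nullD (coefP c) (coefP d)).

Definition fcomb_scale (X : choiceType) (a : R) (c : fcomb R X) : fcomb R X :=
  Fcomb (nullMl a (coefP c)).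

Lemma fcomb_map_id (X : choiceType) (c : fcomb R X) : fcomb_map id c = c.
Proof.
apply: fcomb_ext => x /=; rewrite (infsum1 (x0 := x)) ?eqxx //.
by move=> y /negPf ->.
Qed.

Lemma fcomb_map_comp (X Y Z : choiceType) (g : Y -> Z) (h : X -> Y)
    (c : fcomb R X) :
  fcomb_map (g \o h) c = fcomb_map g (fcomb_map h c).
Proof.
apply: fcomb_ext => z /=.
rewrite -(infsum_fibre h); last exact: (null_if _ (coefP c)).
congr infsum; apply: functional_extensionality_dep => y.
case: ifP => [/eqP gy|gy].
  congr infsum; apply: functional_extensionality_dep => x /=.
  by case: eqP => // ->; rewrite gy eqxx.
rewrite (@infsum_fin _ _ _ fset0) ?big_seq_fset0 // => x _.
by case: eqP => //= ->; rewrite gy.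
Qed.

Lemma fcomb_map_single (X Y : choiceType) (g : X -> Y) a x :
  fcomb_map g (fcomb_single a x) = fcomb_single a (g x).
Proof.
apply: fcomb_ext => y /=; rewrite (infsum1 (x0 := x)) ?eqxx 1?eq_sym //.
by move=> z /negPf ->; case: ifP.
Qed.

Lemma fcomb_map_add (X Y : choiceType) (g : X -> Y) (c d : fcomb R X) :
  fcomb_map g (fcomb_add c d) = fcomb_add (fcomb_map g c) (fcomb_map g d).
Proof.
apply: fcomb_ext => y /=.
rewrite -infsumD; [|exact: (null_if _ (coefP c))|exact: (null_if _ (coefP d))].
congr infsum; apply: functional_extensionality_dep => x.
by case: ifP; rewrite ?addr0.
Qed.

Lemma fcomb_map_zero (X Y : choiceType) (g : X -> Y) :
  fcomb_map g (fcomb_zero X) = fcomb_zero Y.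
Proof.
apply: fcomb_ext => y /=.
by rewrite (@infsum_fin _ _ _ fset0) ?big_seq_fset0 // => x _; case: ifP.
Qed.

Lemma fcomb_join_single (X : choiceType) a (c : fcomb R X) :
  fcomb_join (fcomb_single a c) = fcomb_scale a c.
Proof.
apply: fcomb_ext => x /=; rewrite (infsum1 (x0 := c)) ?eqxx //.
by move=> d /negPf ->; rewrite mul0r.
Qed.

Lemma fcomb_join_add (X : choiceType) (c d : fcomb R (fcomb R X)) :
  fcomb_join (fcomb_add c d) = fcomb_add (fcomb_join c) (fcomb_join d).
Proof.
apply: fcomb_ext => x /=.
rewrite -infsumD; [|exact: nullMr (coefP c)|exact: nullMr (coefP d)].
by congr infsum; apply: functional_extensionality_dep => a; rewrite mulrDl.
Qed.

Lemma fcomb_scale1 (X : choiceType) (c : fcomb R X) : fcomb_scale 1 c = c.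
Proof. by apply: fcomb_ext => x /=; rewrite mul1r. Qed.

End Monad.

Section ChangeOfRing.
Variables (R S : clinRingType) (f : {rmorphism R -> S}).
Hypothesis fcont : continuous f.

Definition fcomb_ring (X : choiceType) (c : fcomb R X) : fcomb S X :=
  Fcomb (null_morph fcont (coefP c)).

Lemma fcomb_ring_single (X : choiceType) a (x : X) :
  fcomb_ring (fcomb_single a x) = fcomb_single (f a) x.
Proof. by apply: fcomb_ext => y /=; case: ifP; rewrite ?rmorph0. Qed.

Lemma fcomb_ring_add (X : choiceType) (c d : fcomb R X) :
  fcomb_ring (fcomb_add c d) = fcomb_add (fcomb_ring c) (fcomb_ring d).
Proof. by apply: fcomb_ext => y /=; rewrite rmorphD. Qed.

Lemma fcomb_ring_map (X Y : choiceType) (g : X -> Y) (c : fcomb R X) :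
  fcomb_ring (fcomb_map g c) = fcomb_map g (fcomb_ring c).
Proof.
apply: fcomb_ext => y /=.
rewrite -(infsum_morph fcont); last exact: (null_if _ (coefP c)).
congr infsum; apply: functional_extensionality_dep => x.
by case: ifP; rewrite ?rmorph0.
Qed.

Lemma fcomb_ring_join (X : choiceType) (c : fcomb R (fcomb R X)) :
  fcomb_ring (fcomb_join c) =
  fcomb_join (fcomb_map (@fcomb_ring X) (fcomb_ring c)).
Proof.
apply: fcomb_ext => x /=.
rewrite -(infsum_morph fcont); last exact: nullMr (coefP c).
have nf : null_family (fun a => f (c a * a x)).
  by apply: null_morph => //; exact: nullMr (coefP c).
rewrite -(infsum_fibre (@fcomb_ring X) nf).
congr infsum; apply: functional_extensionality_dep => b.
rewrite -infsumMr; last exact: (null_if _ (null_morph fcont (coefP c))).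
congr infsum; apply: functional_extensionality_dep => a.
by case: eqP => [<-|_]; rewrite ?mul0r // rmorphM.
Qed.

End ChangeOfRing.

Record category := Category {
  obj :> Type;
  hom : obj -> obj -> Type;
  idm : forall A, hom A A;
  compm : forall A B C, hom B C -> hom A B -> hom A C;
  comp1m : forall A B (h : hom A B), compm (idm B) h = h;
  compm1 : forall A B (h : hom A B), compm h (idm A) = h;
  compA : forall A B C D (h : hom C D) (g : hom B C) (k : hom A B),
    compm h (compm g k) = compm (compm h g) k }.

Arguments hom {c} A B.
Arguments idm {c} A.
Arguments compm {c A B C} h g.

Record functor (C D : category) := Functor {
  fobj :> C -> D;
  fmor : forall A B : C, hom A B -> hom (fobj A) (fobj B);
  fmor1 : forall A, fmor (idm A) = idm (fobj A);
  fmor_comp : forall A B E (h : hom B E) (g : hom A B),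
    fmor (compm h g) = compm (fmor h) (fmor g) }.

Arguments fmor {C D} f {A B} h.

Record iso (C : category) (A B : C) := Iso {
  iso_hom : hom A B;
  iso_inv : hom B A;
  iso_homK : compm iso_inv iso_hom = idm A;
  iso_invK : compm iso_hom iso_inv = idm B }.

Section FunctorConstructions.

Definition id_functor (C : category) : functor C C :=
  @Functor C C id (fun A B h => h) (fun A => erefl) (fun A B E h g => erefl).

Variables (C D E : category) (G : functor D E) (F : functor C D).

Lemma comp_functor1 A : fmor G (fmor F (idm A)) = idm (G (F A)).
Proof. by rewrite !fmor1. Qed.

Lemma comp_functor_comp A B B' (h : hom B B') (g : hom A B) :
  fmor G (fmor F (compm h g)) = compm (fmor G (fmor F h)) (fmor G (fmor F g)).
Proof. by rewrite !fmor_comp. Qed.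

Definition comp_functor : functor C E :=
  @Functor C E (fun A => G (F A)) (fun A B h => fmor G (fmor F h))
    comp_functor1 comp_functor_comp.

End FunctorConstructions.

Record nat_iso (C D : category) (F G : functor C D) := NatIso {
  nat_iso_at :> forall A, iso (F A) (G A);
  nat_isoP : forall A B (h : hom A B),
    compm (iso_hom (nat_iso_at B)) (fmor F h) =
    compm (fmor G h) (iso_hom (nat_iso_at A)) }.

Definition fully_faithful (C D : category) (F : functor C D) : Prop :=
  forall A B, bijective (fun h : hom A B => fmor F h).

Definition is_equivalence (C D : category) (F : functor C D) : Prop :=
  exists G : functor D C,
    inhabited (nat_iso (comp_functor G F) (id_functor C)) /\
    inhabited (nat_iso (comp_functor F G) (id_functor D)).

Section Pseudopullback.
Variables (A B C : category) (F : functor A C) (G : functor B C).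

Record pspb_obj := PspbObj {
  pspb_left : A;
  pspb_right : B;
  pspb_iso : iso (F pspb_left) (G pspb_right) }.

Record pspb_hom (P Q : pspb_obj) := PspbHom {
  pspb_hom_left : hom (pspb_left P) (pspb_left Q);
  pspb_hom_right : hom (pspb_right P) (pspb_right Q);
  pspb_homP : compm (iso_hom (pspb_iso Q)) (fmor F pspb_hom_left) =
              compm (fmor G pspb_hom_right) (iso_hom (pspb_iso P)) }.

Lemma pspb_hom_ext P Q (h k : pspb_hom P Q) :
  pspb_hom_left h = pspb_hom_left k -> pspb_hom_right h = pspb_hom_right k ->
  h = k.
Proof.
case: h k => [h1 h2 hP] [k1 k2 kP] /= E1 E2; subst k1 k2.
by congr PspbHom; exact: Prop_irrelevance.
Qed.

Lemma pspb_id_subproof P :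
  compm (iso_hom (pspb_iso P)) (fmor F (idm (pspb_left P))) =
  compm (fmor G (idm (pspb_right P))) (iso_hom (pspb_iso P)).
Proof. by rewrite !fmor1 compm1 comp1m. Qed.

Definition pspb_id P : pspb_hom P P := PspbHom (pspb_id_subproof P).

Lemma pspb_comp_subproof P Q Q' (h : pspb_hom Q Q') (k : pspb_hom P Q) :
  compm (iso_hom (pspb_iso Q'))
    (fmor F (compm (pspb_hom_left h) (pspb_hom_left k))) =
  compm (fmor G (compm (pspb_hom_right h) (pspb_hom_right k)))
    (iso_hom (pspb_iso P)).
Proof.
by rewrite !fmor_comp compA pspb_homP -!compA pspb_homP.
Qed.

Definition pspb_comp P Q Q' (h : pspb_hom Q Q') (k : pspb_hom P Q) :
  pspb_hom P Q' := PspbHom (pspb_comp_subproof h k).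

Lemma pspb_comp1m P Q (h : pspb_hom P Q) : pspb_comp (pspb_id Q) h = h.
Proof. by apply: pspb_hom_ext; exact: comp1m. Qed.

Lemma pspb_compm1 P Q (h : pspb_hom P Q) : pspb_comp h (pspb_id P) = h.
Proof. by apply: pspb_hom_ext; exact: compm1. Qed.

Lemma pspb_compA P Q Q' Q'' (h : pspb_hom Q' Q'') (g : pspb_hom Q Q')
    (k : pspb_hom P Q) :
  pspb_comp h (pspb_comp g k) = pspb_comp (pspb_comp h g) k.
Proof. by apply: pspb_hom_ext; exact: compA. Qed.

Definition pseudopullback : category :=
  Category pspb_comp1m pspb_compm1 pspb_compA.

Variables (D : category) (H : functor D A) (K : functor D B).
Variable alpha : nat_iso (comp_functor F H) (comp_functor G K).

Definition comparison_obj (X : D) : pspb_obj := PspbObj (alpha X).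

Definition comparison_hom (X Y : D) (h : hom X Y) :
    pspb_hom (comparison_obj X) (comparison_obj Y) :=
  @PspbHom (comparison_obj X) (comparison_obj Y) (fmor H h) (fmor K h)
    (nat_isoP alpha h).

Lemma comparison1 X : comparison_hom (idm X) = pspb_id (comparison_obj X).
Proof. by apply: pspb_hom_ext; exact: fmor1. Qed.

Lemma comparison_comp X Y Z (h : hom Y Z) (g : hom X Y) :
  comparison_hom (compm h g) = pspb_comp (comparison_hom h) (comparison_hom g).
Proof. by apply: pspb_hom_ext; exact: fmor_comp. Qed.

Definition comparison : functor D pseudopullback :=
  @Functor D pseudopullback comparison_obj comparison_hom
    comparison1 comparison_comp.

Definition is_pseudopullback : Prop := is_equivalence comparison.

End Pseudopullback.

Section LinearMaps.
Variable R : pzRingType.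

Lemma linear_ext (M N : lmodType R) (g h : {linear M -> N}) : g =1 h -> g = h.
Proof.
case: g h => [g [[gA] [gZ]]] [h [[hA] [hZ]]] /= gh.
have {}gh : g = h by apply: functional_extensionality_dep.
by subst h; rewrite (Prop_irrelevance gA hA) (Prop_irrelevance gZ hZ).
Qed.

Definition mod_id (M : lmodType R) : {linear M -> M} := idfun.
Definition mod_comp (M N P : lmodType R) (h : {linear N -> P})
  (g : {linear M -> N}) : {linear M -> P} := h \o g.

Lemma mod_comp1m (M N : lmodType R) (h : {linear M -> N}) :
  mod_comp (mod_id N) h = h.
Proof. exact: linear_ext. Qed.

Lemma mod_compm1 (M N : lmodType R) (h : {linear M -> N}) :
  mod_comp h (mod_id M) = h.
Proof. exact: linear_ext. Qed.

Lemma mod_compA (M N P Q : lmodType R) (h : {linear P -> Q})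
    (g : {linear N -> P}) (k : {linear M -> N}) :
  mod_comp h (mod_comp g k) = mod_comp (mod_comp h g) k.
Proof. exact: linear_ext. Qed.

Definition Mod : category := Category mod_comp1m mod_compm1 mod_compA.

End LinearMaps.

Section RestrFunctor.
Variables (R S : pzRingType) (f : {rmorphism R -> S}).

Section OnMaps.
Variables (M N : lmodType S) (h : {linear M -> N}).

Definition restr_map : restr_scalars f M -> restr_scalars f N := h.

Lemma restr_map_zmod : zmod_morphism restr_map.
Proof. exact: (raddfB h). Qed.

Lemma restr_map_scalable : scalable restr_map.
Proof. by move=> a x; exact: (linearZZ h (f a) x). Qed.

HB.instance Definition _ := GRing.isZmodMorphism.Build
  (restr_scalars f M) (restr_scalars f N) restr_map restr_map_zmod.
HB.instance Definition _ := GRing.isScalable.Build R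
  (restr_scalars f M) (restr_scalars f N) *:%R restr_map restr_map_scalable.

End OnMaps.

Definition restr_fobj (M : Mod S) : Mod R := restr_scalars f M.
Definition restr_fmap (M N : Mod S) (h : hom M N) :
  hom (restr_fobj M) (restr_fobj N) := restr_map h : {linear _ -> _}.

Lemma restr_fmap1 M : restr_fmap (idm M) = idm (restr_fobj M).
Proof. exact: linear_ext. Qed.

Lemma restr_fmap_comp (M N P : Mod S) (h : hom N P) (g : hom M N) :
  restr_fmap (compm h g) = compm (restr_fmap h) (restr_fmap g).
Proof. exact: linear_ext. Qed.

Definition restr_functor : functor (Mod S) (Mod R) :=
  Functor restr_fmap1 restr_fmap_comp.

End RestrFunctor.

Record contramodule (R : clinRingType) := Contramodule {
  contra_sort :> choiceType;
  contra_act : fcomb R contra_sort -> contra_sort;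
  contra_unit : forall p, contra_act (fcomb_unit R p) = p;
  contra_assoc : forall c,
    contra_act (fcomb_map contra_act c) = contra_act (fcomb_join c) }.

Arguments contra_act {R} P c : rename.

Section ContraCategory.
Variable R : clinRingType.

Record contra_hom (P Q : contramodule R) := ContraHom {
  contra_fun :> P -> Q;
  contra_homP : forall c,
    contra_fun (contra_act P c) = contra_act Q (fcomb_map contra_fun c) }.

Lemma contra_hom_ext P Q (h k : contra_hom P Q) : h =1 k -> h = k.
Proof.
case: h k => [h hP] [k kP] /= hk.
have {}hk : h = k by apply: functional_extensionality_dep.
by subst k; congr ContraHom; exact: Prop_irrelevance.
Qed.

Lemma contra_id_subproof (P : contramodule R) c :
  id (contra_act P c) = contra_act P (fcomb_map id c).
Proof. by rewrite fcomb_map_id. Qed.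

Definition contra_id (P : contramodule R) : contra_hom P P :=
  ContraHom (@contra_id_subproof P).

Lemma contra_comp_subproof P Q T (h : contra_hom Q T) (g : contra_hom P Q) c :
  (h \o g) (contra_act P c) = contra_act T (fcomb_map (h \o g) c).
Proof. by rewrite /= !contra_homP fcomb_map_comp. Qed.

Definition contra_comp P Q T (h : contra_hom Q T) (g : contra_hom P Q) :
  contra_hom P T := ContraHom (contra_comp_subproof h g).

Lemma contra_comp1m P Q (h : contra_hom P Q) : contra_comp (contra_id Q) h = h.
Proof. exact: contra_hom_ext. Qed.

Lemma contra_compm1 P Q (h : contra_hom P Q) : contra_comp h (contra_id P) = h.
Proof. exact: contra_hom_ext. Qed.

Lemma contra_compA P Q T T' (h : contra_hom T T') (g : contra_hom Q T)
    (k : contra_hom P Q) :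
  contra_comp h (contra_comp g k) = contra_comp (contra_comp h g) k.
Proof. exact: contra_hom_ext. Qed.

Definition Contra : category :=
  Category contra_comp1m contra_compm1 contra_compA.

End ContraCategory.

Definition contra_mod (R : clinRingType) (P : contramodule R) : Type := P.

Section ContraModule.
Variables (R : clinRingType) (P : contramodule R).

HB.instance Definition _ := Choice.copy (contra_mod P) P.

Implicit Types (p q : contra_mod P) (c d : fcomb R P).

Definition contra_lin1 (a : R) (p : contra_mod P) : fcomb R P :=
  fcomb_single a (p : P).

Definition contra_zero : contra_mod P := contra_act P (fcomb_zero R P).

(* The module structure is the restriction of the contra-action to finite
   linear combinations. *)
Definition contra_add p q : contra_mod P :=
  contra_act P (fcomb_add (contra_lin1 1 p) (contra_lin1 1 q)).

Definition contra_scale (a : R) p : contra_mod P :=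
  contra_act P (contra_lin1 a p).

Definition contra_opp p : contra_mod P := contra_scale (-1) p.

Lemma contra_addE c d :
  contra_add (contra_act P c) (contra_act P d) = contra_act P (fcomb_add c d).
Proof.
rewrite /contra_add /contra_lin1 -!fcomb_map_single -fcomb_map_add contra_assoc.
by rewrite fcomb_join_add !fcomb_join_single !fcomb_scale1.
Qed.

Lemma contra_scaleE a c :
  contra_scale a (contra_act P c) = contra_act P (fcomb_scale a c).
Proof.
by rewrite /contra_scale /contra_lin1 -fcomb_map_single contra_assoc
  fcomb_join_single.
Qed.

Lemma contra_surj p : exists c, p = contra_act P c.
Proof. by exists (fcomb_unit R (p : P)); rewrite contra_unit. Qed.

Lemma contra_addA : associative contra_add.
Proof.
move=> p q r; have [c ->] := contra_surj p; have [d ->] := contra_surj q.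
have [e ->] := contra_surj r; rewrite !contra_addE.
by congr contra_act; apply: fcomb_ext => x; exact: addrA.
Qed.

Lemma contra_addC : commutative contra_add.
Proof.
move=> p q; have [c ->] := contra_surj p; have [d ->] := contra_surj q.
by rewrite !contra_addE; congr contra_act; apply: fcomb_ext => x; exact: addrC.
Qed.

Lemma contra_add0 : left_id contra_zero contra_add.
Proof.
move=> p; have [c ->] := contra_surj p.
by rewrite contra_addE; congr contra_act; apply: fcomb_ext => x; exact: add0r.
Qed.

Lemma contra_addN : left_inverse contra_zero contra_opp contra_add.
Proof.
move=> p; have [c ->] := contra_surj p.
rewrite /contra_opp contra_scaleE contra_addE; congr contra_act.
by apply: fcomb_ext => x /=; rewrite mulN1r addNr.
Qed.

HB.instance Definition _ := GRing.isZmodule.Build (contra_mod P)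
  contra_addA contra_addC contra_add0 contra_addN.

Lemma contra_scaleA a b p :
  contra_scale a (contra_scale b p) = contra_scale (a * b) p.
Proof.
have [c ->] := contra_surj p; rewrite !contra_scaleE; congr contra_act.
by apply: fcomb_ext => x /=; rewrite mulrA.
Qed.

Lemma contra_scale1 : left_id 1 contra_scale.
Proof. by move=> p; exact: contra_unit. Qed.

Lemma contra_scaleDr : right_distributive contra_scale +%R.
Proof.
move=> a p q; have [c ->] := contra_surj p; have [d ->] := contra_surj q.
rewrite [_ + _ in LHS]contra_addE !contra_scaleE.
rewrite [RHS]contra_addE; congr contra_act.
by apply: fcomb_ext => x /=; rewrite mulrDr.
Qed.

Lemma contra_scaleDl p : {morph contra_scale^~ p : a b / a + b}.
Proof.
move=> a b; have [c ->] := contra_surj p; rewrite !contra_scaleE.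
rewrite [RHS]contra_addE; congr contra_act.
by apply: fcomb_ext => x /=; rewrite mulrDl.
Qed.

HB.instance Definition _ := GRing.Zmodule_isLmodule.Build R (contra_mod P)
  contra_scaleA contra_scale1 contra_scaleDr contra_scaleDl.

End ContraModule.

Section Forget.
Variable R : clinRingType.

Section OnMaps.
Variables (P Q : contramodule R) (h : contra_hom P Q).

Definition forget_map : contra_mod P -> contra_mod Q := h.

Lemma forget_map_scalable : scalable forget_map.
Proof.
by move=> a p; rewrite /forget_map [LHS]contra_homP fcomb_map_single.
Qed.

Lemma forget_mapD p q : forget_map (p + q) = forget_map p + forget_map q.
Proof.
by rewrite /forget_map [LHS]contra_homP fcomb_map_add !fcomb_map_single.
Qed.

Lemma forget_map_zmod : zmod_morphism forget_map.
Proof.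
by move=> p q; rewrite forget_mapD -scaleN1r forget_map_scalable scaleN1r.
Qed.

HB.instance Definition _ := GRing.isZmodMorphism.Build
  (contra_mod P) (contra_mod Q) forget_map forget_map_zmod.
HB.instance Definition _ := GRing.isScalable.Build R
  (contra_mod P) (contra_mod Q) *:%R forget_map forget_map_scalable.

End OnMaps.

Definition forget_fobj (P : Contra R) : Mod R := contra_mod P.
Definition forget_fmap (P Q : Contra R) (h : hom P Q) :
  hom (forget_fobj P) (forget_fobj Q) := forget_map h : {linear _ -> _}.

Lemma forget_fmap1 P : forget_fmap (idm P) = idm (forget_fobj P).
Proof. exact: linear_ext. Qed.

Lemma forget_fmap_comp (P Q T : Contra R) (h : hom Q T) (g : hom P Q) :
  forget_fmap (compm h g) = compm (forget_fmap h) (forget_fmap g).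
Proof. exact: linear_ext. Qed.

Definition forget_functor : functor (Contra R) (Mod R) :=
  Functor forget_fmap1 forget_fmap_comp.

End Forget.

Section ContraRestr.
Variables (R S : clinRingType) (f : {rmorphism R -> S}).
Hypothesis fcont : continuous f.

Definition sharp_act (Q : contramodule S) (c : fcomb R Q) : Q :=
  contra_act Q (fcomb_ring fcont c).

Lemma sharp_unit (Q : contramodule S) q : @sharp_act Q (fcomb_unit R q) = q.
Proof. by rewrite /sharp_act fcomb_ring_single rmorph1 contra_unit. Qed.

Lemma sharp_assoc (Q : contramodule S) c :
  @sharp_act Q (fcomb_map (@sharp_act Q) c) = sharp_act (fcomb_join c).
Proof.
rewrite /sharp_act fcomb_ring_map.
rewrite (fcomb_map_comp (contra_act Q) (@fcomb_ring _ _ _ fcont Q)).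
by rewrite contra_assoc -fcomb_ring_join.
Qed.

Definition sharp_fobj (Q : Contra S) : Contra R :=
  Contramodule (@sharp_unit Q) (@sharp_assoc Q).

Lemma sharp_fmap_subproof (P Q : contramodule S) (h : contra_hom P Q) c :
  h (sharp_act c) = sharp_act (fcomb_map h c).
Proof. by rewrite /sharp_act contra_homP fcomb_ring_map. Qed.

Definition sharp_fmap (P Q : Contra S) (h : hom P Q) :
    hom (sharp_fobj P) (sharp_fobj Q) :=
  @ContraHom R (sharp_fobj P) (sharp_fobj Q) h (sharp_fmap_subproof h).

Lemma sharp_fmap1 P : sharp_fmap (idm P) = idm (sharp_fobj P).
Proof. exact: contra_hom_ext. Qed.

Lemma sharp_fmap_comp (P Q T : Contra S) (h : hom Q T) (g : hom P Q) :
  sharp_fmap (compm h g) = compm (sharp_fmap h) (sharp_fmap g).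
Proof. exact: contra_hom_ext. Qed.

Definition sharp_functor : functor (Contra S) (Contra R) :=
  Functor sharp_fmap1 sharp_fmap_comp.

(* The two composites of the square have the same underlying sets; the
   components of [square_iso] are identity maps. *)
Section Square.
Variable Q : contramodule S.

Notation left_bottom := (contra_mod (sharp_fobj Q)).
Notation top_right := (restr_scalars f (contra_mod Q)).

Definition square_map : left_bottom -> top_right := id.
Definition square_map_inv : top_right -> left_bottom := id.

Lemma square_mapD x y : square_map (x + y) = square_map x + square_map y.
Proof.
rewrite [LHS]/(contra_act Q _) fcomb_ring_add !fcomb_ring_single rmorph1.
by [].
Qed.

Lemma square_map_scalable : scalable square_map.
Proof. by move=> a x; rewrite [LHS]/(contra_act Q _) fcomb_ring_single. Qed.

Lemma square_map_zmod : zmod_morphism square_map.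
Proof.
by move=> x y; rewrite square_mapD -scaleN1r square_map_scalable scaleN1r.
Qed.

Lemma square_map_inv_scalable : scalable square_map_inv.
Proof. by move=> a x; rewrite -[RHS]/(square_map _) square_map_scalable. Qed.

Lemma square_map_inv_zmod : zmod_morphism square_map_inv.
Proof. by move=> x y; rewrite -[RHS]/(square_map _) square_map_zmod. Qed.

HB.instance Definition _ := GRing.isZmodMorphism.Build
  left_bottom top_right square_map square_map_zmod.
HB.instance Definition _ := GRing.isScalable.Build R
  left_bottom top_right *:%R square_map square_map_scalable.
HB.instance Definition _ := GRing.isZmodMorphism.Build
  top_right left_bottom square_map_inv square_map_inv_zmod.
HB.instance Definition _ := GRing.isScalable.Build R
  top_right left_bottom *:%R square_map_inv square_map_inv_scalable.

End Square.

Section SquareIso.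

Let F := comp_functor (forget_functor R) sharp_functor.
Let G := comp_functor (restr_functor f) (forget_functor S).

Definition square_hom (Q : Contra S) : hom (F Q) (G Q) :=
  @square_map Q : {linear _ -> _}.
Definition square_inv (Q : Contra S) : hom (G Q) (F Q) :=
  @square_map_inv Q : {linear _ -> _}.

Lemma square_homK Q : compm (square_inv Q) (square_hom Q) = idm (F Q).
Proof. exact: linear_ext. Qed.

Lemma square_invK Q : compm (square_hom Q) (square_inv Q) = idm (G Q).
Proof. exact: linear_ext. Qed.

Lemma square_natural (P Q : Contra S) (h : hom P Q) :
  compm (square_hom Q) (fmor F h) = compm (fmor G h) (square_hom P).
Proof. exact: linear_ext. Qed.

Definition square_iso : nat_iso F G :=
  @NatIso _ _ F G (fun Q => Iso (square_homK Q) (square_invK Q)) square_natural.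

End SquareIso.

End ContraRestr.

Section Proflat.
Variables (R S : topologicalRingType) (f : {rmorphism R -> S}).

(* The right ideal of [S] generated by [f(I)]. *)
Definition ext_right_ideal (I : set R) : set S :=
  smallest (@is_right_ideal S) (f @` I).

Definition ext_closure (I : set R) : set S := closure (ext_right_ideal I).

Definition strongly_right_taut : Prop :=
  is_nbhs_base0 [set I : set R | [/\ open I, is_ideal I,
    open (ext_closure I) & is_ideal (ext_closure I)]].

Lemma ext_closure_sub (I : ideal R) (J : ideal S) :
  ideal_set J = ext_closure (ideal_set I) -> forall x, I x -> J (f x).
Proof.
move=> JE x Ix; rewrite -[J _]/(ideal_set J (f x)) JE.
by apply: subset_closure => A [_]; apply; exists x.
Qed.

(* The left [R/I]-module [S/J] is obtained from the regular left [S/J]-module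
   by restriction of scalars along [R/I -> S/J]. *)
Definition left_proflat : Prop :=
  [/\ continuous f, strongly_right_taut &
   forall (I : ideal R) (J : ideal S)
     (JE : ideal_set J = ext_closure (ideal_set I)),
   open (ideal_set I) -> open (ideal_set J) ->
   flat (restr_scalars (quotr_map (ext_closure_sub JE)) (quotr J)^o)].

End Proflat.

(* Main.v *)
(* A strongly right taut [f] makes [S[[X]]] the [R]-subcontramodule generated by
   [S[X]]: every zero-convergent family in [S] can be written as
   [sum_i f(r_i) t_i] with [r_i -> 0] in [R].  Since the [R]-linear maps between
   [R]-contramodules are contramodule morphisms, an [R]-linear map from [S[[X]]]
   to an [R]-contramodule is determined by its restriction to [S[X]], and an
   [S]-linear map of [S]-contramodules is a morphism.

   Let [P] be an [R]-contramodule.  A family of [R]-linear maps [h_x : S -> P]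
   extends to [S[[X]] -> P] by [sum_i f(r_i) t_i x_i |-> sum_i r_i h_{x_i}(t_i)];
   this kills the relations involving a single [x], because [h_x] is a morphism,
   and flatness of [S/J] over [R/I] presents every relation as a
   zero-convergent combination of such ones.  The extension makes [Hom_R(S, P)] an
   [R]-contramodule.  If [P] carries a compatible [S]-module structure, then the
   [R]-linear map [P -> Hom_R(S, P)], [p |-> (t |-> t p)], is a morphism, that is,
   [t (sum_i r_i p_i) = sum_i (t f(r_i)) p_i]; this is what makes the extension
   [S[[P]] -> P] of the [S]-action an [S]-contramodule structure. *)

Require Import Defs.
From HB Require Import structures.
From mathcomp Require Import all_boot all_algebra finmap.
From mathcomp Require Import boolp classical_sets functions cardinality.
From mathcomp Require Import filter topology tvs.
From mathcomp Require Import generic_quotient ring_quotient freeg.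

Set Implicit Arguments.
Unset Strict Implicit.
Unset Printing Implicit Defensive.

Import GRing.Theory.

Local Open Scope classical_set_scope.
Local Open Scope ring_scope.

(** * Free contramodules *)

Section Pairing.
Variable R : clinRingType.
Implicit Types X Y : choiceType.

Lemma infsum_map X Y (g : X -> Y) (c : fcomb R X) (v : Y -> R) :
  infsum (fun y => fcomb_map g c y * v y) = infsum (fun x => c x * v (g x)).
Proof.
rewrite -(infsum_fibre g (nullMr _ (coefP c))).
congr infsum; apply: funext => y.
rewrite -infsumMr; last exact: (null_if _ (coefP c)).
by congr infsum; apply: funext => x; case: eqP => [<-|]; rewrite ?mul0r.
Qed.

(** Modulo an open two-sided ideal [I], only the finitely many [a] in [A] have [c a] outside [I],
    and their coefficients lie in [I] off [X0]. Both sides thus reduce to one finite double sum over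
    [A] and [X0], for an arbitrary family [v]. *)
Lemma infsum_join X (c : fcomb R (fcomb R X)) (v : X -> R) :
  infsum (fun x => fcomb_join c x * v x) =
  infsum (fun a : fcomb R X => c a * infsum (fun x => a x * v x)).
Proof.
apply: infsum_eq => [|U]; first exact: nullMr (coefP _).
have [I [_ Il Ir] IU] := small_ideal (open_subgroup_nbhs U).
have [A AI] := null_fset I (coefP c).
have /choice[B BP] : forall a : fcomb R X, exists B : {fset X},
    forall x, x \notin B -> I (a x) by move=> a; exact: null_fset (coefP a).
pose X0 := (\bigcup_(a <- A) B a)%fset.
have X0P a x : a \in A -> x \notin X0 -> I (a x).
  move=> aA xX; apply: BP; apply: contra xX => xB.
  by apply/bigfcupP; exists a; rewrite ?aA.
have cI x a : a \notin A -> I (c a * a x) by move=> /AI; exact: Ir.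
exists X0 => [x xX|]; apply: IU.
  apply: Ir; apply: infsum_mem => [|a]; first exact: nullMr (coefP c).
  by have [aA|/cI] := boolP (a \in A) => //; exact/Il/X0P.
have H1 := infsum_approx (nullMr (fun a : fcomb R X => infsum (fun x => a x * v x))
  (coefP c)) (fun a aA => Ir _ _ (AI a aA)).
have H2 : I (\sum_(a <- A) c a * infsum (fun x => a x * v x) -
   \sum_(a <- A) c a * \sum_(x <- X0) a x * v x).
  rewrite -sumrB; apply: sum_mem => a aA; rewrite -mulrBr; apply: Il.
  apply: infsum_approx => [|x xX]; first exact: nullMr (coefP a).
  exact/Ir/X0P.
have H3 : I (\sum_(x <- X0) (fcomb_join c x - \sum_(a <- A) c a * a x) * v x).
  apply: sum_mem => x _; apply: Ir; apply: infsum_approx => [|a]; last exact: cI.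
  exact: nullMr (coefP c).
have := subgroupB (subgroupD H1 H2) H3.
suff -> : \sum_(x <- X0) (fcomb_join c x - \sum_(a <- A) c a * a x) * v x =
  \sum_(x <- X0) fcomb_join c x * v x -
    \sum_(a <- A) c a * \sum_(x <- X0) a x * v x.
  by rewrite addrA subrK opprB addrA subrK.
under eq_bigr do rewrite mulrBl mulr_suml.
rewrite sumrB exchange_big /=; congr (_ - _); apply: eq_bigr => a _.
by rewrite mulr_sumr; apply: eq_bigr => x _; rewrite mulrA.
Qed.

Lemma infsum_delta X (x0 : X) (a : R) (v : X -> R) :
  infsum (fun x => fcomb_single a x0 x * v x) = a * v x0.
Proof.
by rewrite (infsum1 (x0 := x0)) /= ?eqxx // => x /negPf ->; rewrite mul0r.
Qed.

Lemma fcomb_mapE X Y (g : X -> Y) (c : fcomb R X) y :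
  fcomb_map g c y = infsum (fun x => c x * (g x == y)%:R).
Proof.
by congr infsum; apply: funext => x; case: ifP; rewrite ?mulr1 ?mulr0.
Qed.

Lemma fcomb_join_map X Y (g : X -> fcomb R Y) (c : fcomb R X) y :
  fcomb_join (fcomb_map g c) y = infsum (fun x => c x * g x y).
Proof. exact: (infsum_map g c (fun a : fcomb R Y => a y)). Qed.

Lemma fcomb_joinA X (c : fcomb R (fcomb R (fcomb R X))) :
  fcomb_join (fcomb_map (@fcomb_join R X) c) = fcomb_join (fcomb_join c).
Proof.
by apply: fcomb_ext => x; rewrite fcomb_join_map [RHS]/= infsum_join.
Qed.

Lemma fcomb_map_join X Y (g : X -> Y) (c : fcomb R (fcomb R X)) :
  fcomb_map g (fcomb_join c) = fcomb_join (fcomb_map (fcomb_map g) c).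
Proof.
apply: fcomb_ext => y; rewrite fcomb_join_map fcomb_mapE infsum_join.
by congr infsum; apply: funext => a; rewrite fcomb_mapE.
Qed.

Lemma fcomb_join_unit X (c : fcomb R X) : fcomb_join (fcomb_unit R c) = c.
Proof. by rewrite fcomb_join_single fcomb_scale1. Qed.

Lemma eq_fcomb_map X Y (g h : X -> Y) (c : fcomb R X) :
  (forall x, c x != 0 -> g x = h x) -> fcomb_map g c = fcomb_map h c.
Proof.
move=> gh; apply: fcomb_ext => y; rewrite !fcomb_mapE.
congr infsum; apply: funext => x; have [->|/gh ->//] := eqVneq (c x) 0.
by rewrite !mul0r.
Qed.

Definition free_contra X : contramodule R :=
  Contramodule (@fcomb_join_unit X) (@fcomb_joinA X).

Definition free_map X Y (g : X -> Y) :
    contra_hom (free_contra X) (free_contra Y) :=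
  @ContraHom _ (free_contra X) (free_contra Y) (fcomb_map g) (@fcomb_map_join X Y g).

Lemma contra_ext_subproof X (P : contramodule R) (h : X -> P)
    (c : fcomb R (free_contra X)) :
  contra_act P (fcomb_map h (contra_act (free_contra X) c)) =
  contra_act P (fcomb_map (fun d : fcomb R X => contra_act P (fcomb_map h d)) c).
Proof.
by rewrite fcomb_map_join -contra_assoc -fcomb_map_comp.
Qed.

Definition contra_ext X (P : contramodule R) (h : X -> P) :
  contra_hom (free_contra X) P := ContraHom (contra_ext_subproof h).

Lemma contra_ext_single X (P : contramodule R) (h : X -> P) a x :
  contra_ext h (fcomb_single a x) = (a *: (h x : contra_mod P)).
Proof. by rewrite /= fcomb_map_single. Qed.

Lemma free_coefD X (c d : contra_mod (free_contra X)) x :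
  coef (c + d) x = coef c x + coef d x.
Proof.
rewrite -[c + d]/(fcomb_join (fcomb_add (fcomb_single 1 (c : fcomb R X))
  (fcomb_single 1 (d : fcomb R X)))).
by rewrite fcomb_join_add !fcomb_join_single /= !mul1r.
Qed.

Lemma free_coefZ X a (c : contra_mod (free_contra X)) x :
  coef (a *: c) x = a * coef c x.
Proof.
rewrite -[a *: c]/(fcomb_join (fcomb_single a (c : fcomb R X))).
by rewrite fcomb_join_single.
Qed.

Lemma free_coef0 X x : coef (0 : contra_mod (free_contra X)) x = 0.
Proof.
by apply: (addrI (coef (0 : contra_mod (free_contra X)) x)); rewrite -free_coefD !addr0.
Qed.

Lemma free_coefB X (c d : contra_mod (free_contra X)) x :
  coef (c - d) x = coef c x - coef d x.
Proof. by rewrite -scaleN1r free_coefD free_coefZ mulN1r. Qed.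

Lemma infsumB X (r r' : X -> R) : null_family r -> null_family r' ->
  infsum (fun x => r x - r' x) = infsum r - infsum r'.
Proof.
move=> nr nr'; rewrite -mulN1r -infsumMl // -infsumD //; last exact: nullMl.
by congr infsum; apply: funext => x; rewrite mulN1r.
Qed.

End Pairing.

(** * Taut chains of ideals *)

Record ideal_chain (R : clinRingType) (I : nat -> ideal R) : Prop := IdealChain {
  chain_open : forall n, open (ideal_set (I n));
  chain_le : forall m n, (m <= n)%N -> ideal_set (I n) `<=` ideal_set (I m);
  chain_base : forall U : open_subgroup R, exists n, ideal_set (I n) `<=` U }.

Definition chain_subgroup (R : clinRingType) (I : nat -> ideal R)
  (cI : ideal_chain I) n : open_subgroup R := @OpenSubgroup R (I n) (chain_open cI n).

(** * Successive approximation along a chain of open ideals *)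

Section Approximation.
Variables (R T : clinRingType) (f : {rmorphism R -> T}).
Hypothesis fcont : continuous f.
Variables (I : nat -> ideal R) (Ichain : ideal_chain I).
Variables (Z X : choiceType) (v : Z -> fcomb T X).

Lemma null_push (d : fcomb R Z) x : null_family (fun z => f (d z) * v z x).
Proof. exact: nullMr (null_morph fcont (coefP d)). Qed.

(* Open mapping principle: an approximate solution at every level of the chain
   gives an exact one, the infinite sum of the corrections. *)
Lemma successive_approximation (Q : nat -> fcomb T X -> Prop) :
    (forall U : open_subgroup T, exists k, forall n c, (k <= n)%N -> Q n c ->
       forall x, U (c x)) ->
    (forall n c, Q n c -> exists2 d : fcomb R Z, forall z, I n (d z) &
       exists2 c', Q n.+1 c' &
         forall x, c' x = c x - infsum (fun z => f (d z) * v z x)) ->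
  forall c, Q 0 c -> exists2 d : fcomb R Z, forall z, I 0 (d z) &
    forall x, c x = infsum (fun z => f (d z) * v z x).
Proof.
move=> Qsmall Qstep c Qc.
have /choice[next nextP] : forall p : nat * fcomb T X, exists q : fcomb R Z * fcomb T X,
    Q p.1 p.2 -> [/\ forall z, I p.1 (q.1 z), Q p.1.+1 q.2 &
      forall x, q.2 x = p.2 x - infsum (fun z => f (q.1 z) * v z x)].
  move=> [n b]; have [/Qstep[d dI [b' Qb' bE]]|nQ] := pselect (Q n b).
    by exists (d, b').
  by exists (fcomb_zero R Z, b).
pose cs := fix cs n := if n is m.+1 then (next (m, cs m)).2 else c.
have Qcs n : Q n (cs n) by elim: n => [|n /= IH] //; have [] := nextP (n, cs n) IH.
pose d n := (next (n, cs n)).1.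
have dI n z : I n (d n z) by have [] := nextP (n, cs n) (Qcs n).
have csE n x : cs n.+1 x = cs n x - infsum (fun z => f (d n z) * v z x).
  by have [] := nextP (n, cs n) (Qcs n).
have nd k z : null_family (fun n => if (k <= n)%N then d n z else 0).
  apply: null_if; apply: fset_null => U; have [j jU] := chain_base Ichain U.
  exists [fset i in iota 0 j]%fset => n; rewrite !inE mem_iota /= add0n -leqNgt => jn.
  exact/jU/(chain_le Ichain jn)/dI.
(* From stage [j] on all corrections lie in [U], so only the finitely many earlier ones have
   coefficients outside [U]. *)
have nD k : null_family (fun z => infsum (fun n => if (k <= n)%N then d n z else 0)).
  apply: fset_null => U; have [j jU] := chain_base Ichain U.
  have /choice[B BP] : forall n, exists B : {fset Z}, forall z, z \notin B -> U (d n z).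
    by move=> n; exact: null_fset (coefP (d n)).
  exists (\bigcup_(n <- iota 0 j) B n)%fset => z zB.
  apply: infsum_mem => // n; case: ifP => _; last exact: subgroup0.
  have [jn|nj] := leqP j n; first exact/jU/(chain_le Ichain jn)/dI.
  apply: BP; apply: contra zB => zB; apply/bigfcupP; exists n => //.
  by rewrite mem_iota /= add0n nj.
(* [D k] sums the corrections from stage [k] on: [D 0] is the solution, [D k] its remainder after
   [k] stages. *)
pose D k := Fcomb (nD k).
have DI k z : I k (D k z).
  apply: (@infsum_mem _ _ (chain_subgroup Ichain k)) => //= n.
  case: ifP => [kn|_]; last exact: subgroup0 (I k).
  exact/(chain_le Ichain kn)/dI.
have DS k z : D k z = d k z + D k.+1 z.
  rewrite /D /=; transitivity (infsum (fun n =>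
    (if n == k then d k z else 0) + (if (k < n)%N then d n z else 0))).
    congr infsum; apply: funext => n.
    by case: ltngtP => [||<-]; rewrite ?add0r ?addr0.
  rewrite infsumD; [|exact: null_single|exact: nd].
  by rewrite (infsum1 (x0 := k)) ?eqxx // => n /negPf ->.
exists (D 0%N) => // x; apply: Defs.separated => U.
have [V iV VU] := small_ideal (open_subgroup_nbhs U).
have [_ _ Vr] := iV.
have [j jV] := chain_base Ichain (preim_open_subgroup fcont V).
have [k kU] := Qsmall U.
(* From stage [k] on the error [cs n] lies in [U]; from stage [j] on [f] maps the tail [D n] into
   [V]. The error minus the value of the tail is the same at every stage. *)
pose n := maxn j k.
have -> : c x - infsum (fun z => f (D 0%N z) * v z x) =
    cs n x - infsum (fun z => f (D n z) * v z x).
  elim: n => [//|n ->]; rewrite csE -addrA; congr (_ + _).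
  rewrite -opprD -infsumD; try exact: null_push.
  by congr (- infsum _); apply: funext => z; rewrite DS rmorphD mulrDl.
apply: subgroupB; first exact: (kU n _ (leq_maxr _ _)).
apply/VU/infsum_mem => [|z]; first exact: null_push.
by apply/Vr/jV/(chain_le Ichain (leq_maxl j k))/DI.
Qed.

End Approximation.

(** * Taut chains from a countable base *)

Section TautChain.
Variables (R S : clinRingType) (f : {rmorphism R -> S}).

(** Each [I n.+1] is a taut ideal chosen inside [I n] and inside the [n]-th set [e n] of an
    enumeration covering the base. The chain starts at the unit ideal, so that level 0 puts no
    condition on coefficients. *)
Lemma taut_chain : countable_nbhs_base0 R -> continuous f ->
    strongly_right_taut f ->
  exists (I : nat -> ideal R) (J : nat -> ideal S),
    [/\ ideal_chain I, ideal_chain J,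
        forall n, ideal_set (J n) = ext_closure f (ideal_set (I n)) &
        ideal_set (I 0) = setT].
Proof.
move=> [B Bc [B0 Bb]] fc [T0 Tb].
pose T := {I : ideal R | [/\ open (ideal_set I),
  open (ext_closure f (ideal_set I)) & is_ideal (ext_closure f (ideal_set I))]}.
have Tex N : nbhs (0 : R) N -> exists I : T, ideal_set (sval I) `<=` N.
  move=> /Tb[I [oI iI oJ iJ] IN].
  have H : [/\ open (ideal_set (Ideal iI)),
    open (ext_closure f (ideal_set (Ideal iI))) &
    is_ideal (ext_closure f (ideal_set (Ideal iI)))] by [].
  by exists (exist _ (Ideal iI) H).
have [e eP] : exists e : nat -> set R, forall U, B U -> exists n, e n = U.
  have /countable_injP[h hi] := Bc.
  (* An index that is not [h U] for any [U] in [B] receives the default [setT]. *)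
  pose e n := xget setT [set U | B U /\ h U = n].
  exists e => U BU; exists (h U); rewrite /e; case: xgetP => [W _ [BW hW]|].
    by apply: hi; rewrite ?inE.
  by move=> /(_ U) [].
have iT (V : pzRingType) : is_ideal [set: V] by split=> //.
have fT : ext_closure f [set: R] = setT.
  apply/seteqP; split=> // s _; apply: subset_closure => A [[_ Ar] fA].
  by rewrite -[s]mul1r; apply/Ar/fA; exists 1; rewrite ?rmorph1.
have HT : [/\ open (ideal_set (Ideal (iT R))),
    open (ext_closure f (ideal_set (Ideal (iT R)))) &
    is_ideal (ext_closure f (ideal_set (Ideal (iT R))))].
  by rewrite /= fT; split=> //; exact: openT.
have /choice[next nextP] : forall p : nat * T, exists q : T,
    nbhs (0 : R) (e p.1) -> ideal_set (sval q) `<=` e p.1 `&` ideal_set (sval p.2).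
  move=> [n I]; have [en|nen] := pselect (nbhs (0 : R) (e n)); last by exists I.
  have [|q qP] := Tex (e n `&` ideal_set (sval I)); last by exists q.
  apply: filterI => //; apply: open_nbhs_nbhs; split; first by case: (svalP I).
  exact: subgroup0 (sval I).
have /choice[meet meetP] : forall p : T * T, exists q : T,
    ideal_set (sval q) `<=` ideal_set (sval p.1) `&` ideal_set (sval p.2).
  move=> [I J]; apply: Tex; apply: filterI; apply: open_nbhs_nbhs; split;
  by [case: (svalP I)|exact: subgroup0 (sval I)|case: (svalP J)|exact: subgroup0 (sval J)].
pose I := fix I n : T := if n is m.+1 then meet (next (m, I m), I m) else exist _ _ HT.
have Ile m n : (m <= n)%N -> ideal_set (sval (I n)) `<=` ideal_set (sval (I m)).
  elim: n => [|n IH]; first by case: m.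
  rewrite leq_eqVlt => /predU1P[->//|/IH mn] x /= /meetP[_]; exact: mn.
pose J n := Ideal (let: And3 _ _ H := svalP (I n) in H).
have Ichain : ideal_chain (fun n => sval (I n)).
  split=> [n||U]; [by case: (svalP (I n))|exact: Ile|].
  have [W BW WU] := Bb _ (open_subgroup_nbhs U).
  have [n enW] := eP _ BW; exists n.+1 => x /= /meetP[/= In _]; apply: WU.
  by move: In => /nextP; rewrite /= enW => /(_ (B0 _ BW))[].
exists (fun n => sval (I n)), J; split=> //.
split=> [n|m n mn|U]; first by case: (svalP (I n)).
  apply: closureS => x Hx A [rA fA]; apply: Hx; split=> // _ [y /(Ile _ _ mn) Iy <-].
  by apply: fA; exists y.
(* [V] is a right ideal containing [f (I n)], hence contains the right ideal generated by it; being
   an open subgroup, it is closed, so it contains [J n] too. *)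
have [V [_ _ Vr] VU] := small_ideal (open_subgroup_nbhs U).
have [n nV] := chain_base Ichain (preim_open_subgroup fc V).
exists n => s Js.
have [|s' [Hs Vs]] := Js [set s' | V (s - s')].
  by apply: (nbhs_subl (N := subgroup_set V)); rewrite subrr; exact: open_subgroup_nbhs.
have Vs' : V s'.
  apply: Hs; split; first by split=> //; exact: (subgroupP V).
  by move=> _ [x Ix <-]; exact: nV.
by apply/VU; rewrite -(subrK s' s); apply: subgroupD.
Qed.

End TautChain.

(** * Restricting free contramodules along [f] *)

Lemma infsum_slice (R : clinRingType) (X Y : choiceType) (x : X) (r : Y * X -> R) :
  null_family r -> (forall t y, y != x -> r (t, y) = 0) ->
  infsum r = infsum (fun t => r (t, x)).
Proof.
move=> nr r0; rewrite -(infsum_fibre fst nr); congr infsum; apply: funext => t.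
rewrite (infsum1 (x0 := (t, x))) ?eqxx // => -[u y] /=.
by rewrite xpair_eqE negb_and; case: eqP => [->/= /r0->|].
Qed.

(** Fullness provides a contramodule morphism with the same underlying function. In this form the
    assumption on [R] is applied to linear maps. *)
Lemma contra_linear (R : clinRingType) (P Q : contramodule R)
    (g : {linear contra_mod P -> contra_mod Q}) :
  fully_faithful (forget_functor R) ->
  forall c, g (contra_act P c) = contra_act Q (fcomb_map (g : P -> Q) c).
Proof.
move=> /(_ P Q)[g' _ gK] c.
have gE : (g : P -> Q) = contra_fun (g' g).
  by apply: funext => p; rewrite -[in LHS](gK g).
by rewrite [in RHS]gE -contra_homP -gE.
Qed.

Section FreeRestricted.
Variables (R S : clinRingType) (f : {rmorphism R -> S}).
Hypothesis fcont : continuous f.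
Implicit Types X : choiceType.

Definition sharp_free X : contramodule R := sharp_fobj fcont (free_contra S X).

Definition push_gen X (z : S * X) : fcomb S X := fcomb_single z.1 z.2.

(* [push] is [sum_i r_i (t_i, x_i) |-> sum_i f(r_i) t_i x_i]. *)
Definition push X : contra_hom (free_contra R (S * X)%type) (sharp_free X) :=
  contra_ext (P := sharp_free X) (@push_gen X).

(** The module structures that [S[[X]]] gets as an [R]-contramodule and as an [S]-contramodule are
    built separately on one set; [square_map] identifies them. *)
Lemma sharp_freeD X (c d : contra_mod (sharp_free X)) :
  (c + d) = ((c : contra_mod (free_contra S X)) + d : contra_mod (free_contra S X)).
Proof. exact: (@square_mapD R S f fcont (free_contra S X) c d). Qed.

Lemma sharp_freeZ X r (c : contra_mod (sharp_free X)) :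
  r *: c = (f r *: (c : contra_mod (free_contra S X)) : contra_mod (free_contra S X)).
Proof. exact: (@square_map_scalable R S f fcont (free_contra S X) r c). Qed.

Lemma sharp_coefD X (c d : contra_mod (sharp_free X)) x :
  coef (c + d : fcomb S X) x = coef (c : fcomb S X) x + coef (d : fcomb S X) x.
Proof. by rewrite sharp_freeD free_coefD. Qed.

Lemma sharp_coefZ X r (c : contra_mod (sharp_free X)) x :
  coef (r *: c : fcomb S X) x = f r * coef (c : fcomb S X) x.
Proof. by rewrite sharp_freeZ free_coefZ. Qed.

Lemma sharp_coefB X (c d : contra_mod (sharp_free X)) x :
  coef (c - d : fcomb S X) x = coef (c : fcomb S X) x - coef (d : fcomb S X) x.
Proof. by rewrite -scaleN1r sharp_coefD sharp_coefZ rmorphN1 mulN1r. Qed.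

Lemma pushE X (d : fcomb R (S * X)%type) x :
  coef (push X d : fcomb S X) x = infsum (fun z => f (d z) * push_gen z x).
Proof.
rewrite -[push X d]/(fcomb_join (fcomb_ring fcont (fcomb_map (@push_gen X) d))).
by rewrite fcomb_ring_map fcomb_join_map.
Qed.

Lemma null_sum (d : fcomb R S) : null_family (fun t => f (d t) * t).
Proof. exact: nullMr (null_morph fcont (coefP d)). Qed.

(** The sums of [f (d t) * t] with [d] valued in [I] form a right ideal containing [f(I)], where
    right multiplication by [a] relabels [t] as [t * a]. A point of the closure is therefore within
    [V] of such a sum. *)
Lemma ext_closure_approx (I : ideal R) (V : open_subgroup S) s :
  open (ideal_set I) -> ext_closure f (ideal_set I) s ->
  exists2 d : fcomb R S, forall t, I (d t) & V (s - infsum (fun t => f (d t) * t)).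
Proof.
move=> oI Is; pose U := @OpenSubgroup R I oI.
have [_ Il Ir] := idealP I.
pose A := [set infsum (fun t => f (d t) * t) | d in [set d : fcomb R S | forall t, I (d t)]].
have Ar : is_right_ideal A.
  split; first split.
  - exists (fcomb_zero R S) => [t|]; first exact: subgroup0 I.
    by rewrite (infsum1 (x0 := 0)) ?mulr0 // => t _ /=; rewrite rmorph0 mul0r.
  - move=> _ _ [c cI <-] [d dI <-].
    exists (fcomb_add c (fcomb_scale (-1) d)) => [t /=|].
      by rewrite mulN1r; apply: (subgroupB (A := I)); [exact: cI|exact: dI].
    rewrite -infsumB; try exact: null_sum.
    congr infsum; apply: funext => t /=.
    by rewrite mulN1r rmorphB mulrBl.
  move=> a _ [d dI <-]; exists (fcomb_map (fun t => t * a) d) => [t /=|].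
    apply: (@infsum_mem _ _ U); first exact: (null_if _ (coefP d)).
    by move=> u; case: ifP => _; [exact: dI|exact: subgroup0 I].
  rewrite -infsumMr; last exact: null_sum.
  rewrite -[LHS]/(infsum (fun t => fcomb_ring fcont (fcomb_map _ d) t * t)).
  rewrite fcomb_ring_map (infsum_map _ _ id).
  by congr infsum; apply: funext => t /=; rewrite mulrA.
have [|s' [/(_ A) As Vs]] := Is [set s' | V (s - s')].
  by apply: (nbhs_subl (N := subgroup_set V)); rewrite subrr; exact: open_subgroup_nbhs.
have [|d dI ds] := As; last by exists d => //; rewrite ds.
split=> // _ [r Ir' <-]; exists (fcomb_single r (1 : S)) => [t /=|].
    by case: ifP => _ //; exact: subgroup0 I.
  rewrite (infsum1 (x0 := 1)) /= ?eqxx ?mulr1 // => t /negPf ->.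
  by rewrite rmorph0 mul0r.
Qed.

Variables (I : nat -> ideal R) (J : nat -> ideal S).
Hypotheses (Ichain : ideal_chain I) (Jchain : ideal_chain J).
Hypothesis JE : forall n, ideal_set (J n) = ext_closure f (ideal_set (I n)).

(** Successive approximation along the chain shifted by [m]: at stage [n] the error has coefficients
    in [J (m + n)], and [ext_closure_approx] moves each of them into [J (m + n.+1)]. *)
Lemma push_onto m X (c : fcomb S X) : (forall x, J m (c x)) ->
  exists2 d : fcomb R (S * X)%type, forall z, I m (d z) & push X d = c.
Proof.
move=> cJ; pose Im n := I (m + n).
have cIm : ideal_chain Im.
  split=> [n|n n' nn'|U]; first exact: (chain_open Ichain).
    by apply: (chain_le Ichain); rewrite leq_add2l.
  have [k kU] := chain_base Ichain U; exists k.
  exact: subset_trans (chain_le Ichain (leq_addl m k)) kU.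
have [|||d dI cE] := @successive_approximation _ _ f fcont Im cIm _ X (@push_gen X)
  (fun n c => forall x, J (m + n) (c x)) _ _ c.
- move=> U; have [k kU] := chain_base Jchain U; exists k => n c' kn c'J x.
  by apply/kU/(chain_le Jchain _ (c'J x)); rewrite (leq_trans kn) // leq_addl.
- move=> n c' c'J.
  have [A AJ] := null_fset (chain_subgroup Jchain (m + n.+1)) (coefP c').
  have /choice[d dP] : forall x, exists d : fcomb R S, (forall t, I (m + n) (d t)) /\
      J (m + n.+1) (c' x - infsum (fun t => f (d t) * t)).
    move=> x; have := c'J x; rewrite -[J _ _]/(ideal_set _ _) JE.
    move=> /(ext_closure_approx (chain_subgroup Jchain (m + n.+1)) (chain_open Ichain _)).
    by case=> d; exists d.
  (* Only the finitely many [x] in [A] are corrected, which keeps the glued family null; elsewhere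
     [c'] already lies in [J (m + n.+1)]. *)
  have nd : null_family (fun z : S * X => if z.2 \in A then d z.2 z.1 else 0).
    apply: fset_null => U.
    have /choice[B BP] : forall x, exists B : {fset S}, forall t, t \notin B -> U (d x t).
      by move=> x; exact: null_fset (coefP (d x)).
    exists (\bigcup_(x <- A) (fun t => (t, x)) @` B x)%fset => -[t x] /= zB.
    case: ifP => xA; last exact: subgroup0.
    apply: BP; apply: contra zB => tB; apply/bigfcupP; exists x; rewrite ?xA //.
    exact: in_imfset.
  exists (Fcomb nd) => [[t x] /=|].
    by case: ifP => _; [have [dI _] := dP x; exact: dI|exact: (subgroup0 (I _))].
  have nF x : null_family (fun z : S * X => f (Fcomb nd z) * push_gen z x).
    exact: null_push.
  exists ((c' : contra_mod (free_contra S X)) -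
          (push X (Fcomb nd) : contra_mod (free_contra S X))).
    move=> x; rewrite free_coefB pushE.
    rewrite (infsum_slice (x := x)) => [||t y yx]; [|exact: nF|]; last first.
      by rewrite /= eq_sym (negPf yx) mulr0.
    have [xA|xA] := boolP (x \in A).
      have [_] := dP x; congr (J _ (_ - infsum _)); apply: funext => t.
      by rewrite /= xA eqxx.
    rewrite (infsum1 (x0 := 0)) => [|t _]; rewrite /= (negPf xA) rmorph0 mul0r //.
    by rewrite subr0; exact: AJ.
  by move=> x; rewrite free_coefB pushE.
- by rewrite addn0; exact: cJ.
exists d; first by move=> z; have := dI z; rewrite /Im addn0.
by apply: fcomb_ext => x; rewrite pushE cE.
Qed.

Hypothesis I0 : ideal_set (I 0) = setT.

(** At level 0 every coefficient is admissible: [J 0] contains [f 1 = 1], hence all of [S]. *)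
Lemma push_surj X (c : fcomb S X) : exists d, push X d = c.
Proof.
have [|d _ <-] := @push_onto 0 X c; last by exists d.
move=> x; rewrite -[J _ _]/(ideal_set _ _) JE I0.
apply: subset_closure => A [[_ Ar] fA].
by rewrite -[c x]mul1r; apply/Ar/fA; exists 1; rewrite ?rmorph1.
Qed.

Hypothesis Rff : fully_faithful (forget_functor R).

Lemma sharp_free_ext X (P : contramodule R)
    (g h : {linear contra_mod (sharp_free X) -> contra_mod P}) :
  (forall t x, g (fcomb_single t x) = h (fcomb_single t x)) -> g =1 h.
Proof.
move=> gh c; have [d <-] := push_surj c.
rewrite -[push X d]/(contra_act (sharp_free X) (fcomb_map (@push_gen X) d)).
rewrite !contra_linear // -!fcomb_map_comp; congr (contra_act _ (fcomb_map _ _)).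
by apply: funext => -[t x]; exact: gh.
Qed.

End FreeRestricted.

(** * Relations and flatness *)

Lemma gen_subgroup_ind (V : zmodType) (G T : set V) :
  is_subgroup T -> G `<=` T -> gen_subgroup G `<=` T.
Proof. by move=> sT GT x; apply. Qed.

Lemma sub_gen_subgroup (V : zmodType) (G : set V) : G `<=` gen_subgroup G.
Proof. by move=> x Gx A [_]; apply. Qed.

Lemma subgroup_sum (V : zmodType) (A : subgroup V) (K : eqType) (s : seq K) (F : K -> V) :
  (forall k, k \in s -> A (F k)) -> A (\sum_(k <- s) F k).
Proof.
move=> AF; rewrite big_seq; apply: big_ind => //; first exact: subgroup0.
by move=> *; exact: subgroupD.
Qed.

Lemma cls0 (V : zmodType) (A : subgroup V) : cls A 0 = 0.
Proof. by apply: (addrI (cls A 0)); rewrite -clsD !addr0. Qed.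

Lemma cls_sum (V : zmodType) (A : subgroup V) (K : Type) (s : seq K) (g : K -> V) :
  cls A (\sum_(k <- s) g k) = \sum_(k <- s) cls A (g k).
Proof. exact: (big_morph (cls A) (@clsD V A) (cls0 A)). Qed.

(** * Elementary tensors *)

Section Tensor.
Variables (R : pzRingType) (F : lmodType R) (M : lmodType R^c).
Implicit Types (m : M) (x : F).

Definition tens m x : tensor F M := cls (gen_subgroup (@tensor_rel R F M)) << (m, x) >>.

Lemma tensDr m x x' : tens m (x + x') = tens m x + tens m x'.
Proof.
rewrite -clsD; apply/cls_eq; rewrite opprD addrA.
apply: sub_gen_subgroup; exact: TensorAddr.
Qed.

Lemma tensZ m (r : R) x : tens ((r : R^c) *: m) x = tens m (r *: x).
Proof. by apply/cls_eq; apply: sub_gen_subgroup; exact: TensorScale. Qed.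

Lemma tens0r m : tens m 0 = 0.
Proof. by apply: (addrI (tens m 0)); rewrite -tensDr !addr0. Qed.

Lemma tens_sumr m (K : Type) (s : seq K) (y : K -> F) :
  \sum_(k <- s) tens m (y k) = tens m (\sum_(k <- s) y k).
Proof.
elim: s => [|k s IH]; first by rewrite !big_nil tens0r.
by rewrite !big_cons IH tensDr.
Qed.

End Tensor.

Section RightIdeal.
Variables (R : pzRingType) (I' I : ideal R).
Let A := quotr I'.

(** The image of [I] in [A = R/I'], as a submodule of the regular right [A]-module, which is encoded
    as the left module [(A^c)^o]. *)
Definition image_ideal_pred : pred (A^c)^o :=
  fun q => `[< exists2 r, I r & q = cls I' r >].

Lemma image_ideal_closed : submod_closed image_ideal_pred.
Proof.
split.
  apply/asboolP; exists 0; first exact: (subgroup0 I).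
  by rewrite cls0.
move=> a _ _ /asboolP[r Ir ->] /asboolP[s Is ->].
have [_ _ Imr] := idealP I.
apply/asboolP; have [b ->] := cls_surj (a : A).
exists (r * b + s); first by apply: (subgroupD (A := I)) => //; exact: Imr.
(* Scaling by [a] over the opposite ring is right multiplication by [a] in [A]. *)
rewrite -[_ *: _]/((cls I' r : A) * (cls I' b : A)).
by rewrite clsD -cls_mul.
Qed.

HB.instance Definition _ :=
  GRing.isSubmodClosed.Build A^c (A^c)^o image_ideal_pred image_ideal_closed.

Record image_ideal := ImageIdeal {
  image_ideal_val :> (A^c)^o; _ : image_ideal_val \in image_ideal_pred }.

HB.instance Definition _ := [isSub for image_ideal_val].
HB.instance Definition _ := [Choice of image_ideal by <:].
HB.instance Definition _ := [SubChoice_isSubLmodule of image_ideal by <:].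

Lemma image_idealP (q : image_ideal) : exists2 r, I r & val q = cls I' r.
Proof. by case: q => q /= /asboolP. Qed.

Lemma image_ideal_cls r : I r -> cls I' r \in image_ideal_pred.
Proof. by move=> Ir; apply/asboolP; exists r. Qed.

End RightIdeal.

Lemma free_coef_sum (R : clinRingType) (X : choiceType) (K : Type) (s : seq K)
    (g : K -> contra_mod (free_contra R X)) x :
  coef (\sum_(k <- s) g k) x = \sum_(k <- s) coef (g k) x.
Proof.
exact: (big_morph (fun c : contra_mod (free_contra R X) => coef c x)
  (fun c d => free_coefD c d x) (free_coef0 R x)).
Qed.

Lemma scale_split (R : pzRingType) (V : lmodType R) (a b p : R) (x y : V) :
  a *: x - b *: y = (a - b * p) *: x + b *: (p *: x - y).
Proof. by rewrite scalerBr scalerA scalerBl addrA subrK. Qed.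

(** * Flatness as a statement about relations *)

Section FlatRelations.
Variables (R S : clinRingType) (f : {rmorphism R -> S}).
Hypothesis fcont : continuous f.
Variables (I I' : ideal R) (J' : ideal S).
Hypothesis JE : ideal_set J' = ext_closure f (ideal_set I').
Let A := quotr I'.
Let F : lmodType A := restr_scalars (quotr_map (ext_closure_sub JE)) (quotr J')^o.
Hypothesis Fflat : flat F.
Hypothesis I'open : open (ideal_set I').
Hypothesis J'open : open (ideal_set J').
Hypothesis J'span : forall s, J' s ->
  exists2 e : fcomb R S, forall t, I' (e t) & infsum (fun t => f (e t) * t) = s.

Let FM := contra_mod (free_contra R S).

Definition value (d : FM) : S := infsum (fun t => f (coef d t) * t).

Lemma valueB c d : value (c - d) = value c - value d.
Proof.
rewrite -infsumB; try exact: null_sum.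
by congr infsum; apply: funext => t; rewrite free_coefB rmorphB mulrBl.
Qed.

Lemma value_single (r : R) (t : S) : value (fcomb_single r t) = f r * t.
Proof.
rewrite /value (infsum1 (x0 := t)) /= ?eqxx // => u /negPf ->.
by rewrite rmorph0 mul0r.
Qed.

(* A relation with coefficients in [I] is, modulo [I'], a combination of exact
   relations with coefficients in [I]; this is the injectivity of
   [I/I' (x) S/J' -> S/J'] ([flat_relation] below). *)
Definition flat_gens : set FM :=
  [set c | (forall t, I' (coef c t)) \/
     exists r d, [/\ I r, value d = 0 & c = r *: d]].

Local Notation G := (gen_subgroup flat_gens).

Lemma flat_gens_small c : (forall t, I' (coef c t)) -> G c.
Proof. by move=> H; apply: sub_gen_subgroup; left. Qed.

(** A combination [d] with value merely in [J'] becomes an exact relation after subtracting some [e]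
    with coefficients in [I'], and [r *: e] still has coefficients in [I']. *)
Lemma flat_gens_scale r (d : FM) : I r -> J' (value d) -> G (r *: d).
Proof.
move=> Ir /J'span[e eI' de].
have [_ Il _] := idealP I'.
rewrite -(subrK (e : FM) d) scalerDr; apply: subgroupD.
  apply: sub_gen_subgroup; right; exists r, (d - (e : FM)); split=> //.
  by rewrite valueB -[value (e : FM)]/(infsum _) de subrr.
by apply: flat_gens_small => t; rewrite free_coefZ; apply: Il; exact: eI'.
Qed.

Lemma single_small r t : I' r -> G (fcomb_single r t : FM).
Proof.
move=> Ir; apply: flat_gens_small => u /=.
by case: ifP => _ //; exact: (subgroup0 I').
Qed.

Lemma scaleF p t : (cls I' p : A) *: (cls J' t : F) = (cls J' (f p * t) : F).
Proof.
rewrite -[LHS]/(quotr_mul (quotr_map (ext_closure_sub JE) (cls I' p)) (cls J' t)).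
by rewrite /quotr_map quot_mapE cls_mul.
Qed.

Let unit1 (t : S) : FM := fcomb_single 1 t.

Lemma value_unit1 t : value (unit1 t) = t.
Proof. by rewrite value_single rmorph1 mul1r. Qed.

Lemma single_scale r (t : S) : (fcomb_single r t : FM) = r *: unit1 t.
Proof.
apply: fcomb_ext => u; rewrite [RHS]free_coefZ /=.
by case: ifP; rewrite ?mulr1 ?mulr0.
Qed.

Lemma singleB r s (t : S) :
  (fcomb_single r t : FM) - (fcomb_single s t : FM) = (fcomb_single (r - s) t : FM).
Proof. by rewrite !single_scale -scalerBl. Qed.

(** This moves [p] across the tensor sign: [a t - b t'] is [(a - b p) t], with coefficient in [I'],
    plus [b (p t - t')], where [p t - t'] has value in [J']. *)
Lemma flat_gens_single a b p (t t' : S) :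
  I b -> I' (a - b * p) -> J' (f p * t - t') ->
  G ((fcomb_single a t : FM) - (fcomb_single b t' : FM)).
Proof.
move=> bI abI' ptJ'; rewrite !single_scale (scale_split a b p).
apply: subgroupD; first by rewrite -single_scale; exact: single_small.
by apply: flat_gens_scale; rewrite // valueB -single_scale value_single value_unit1.
Qed.

(** The finitely many terms of [u] with coefficient outside [I'] give an element of the tensor
    product of the image of [I] in [R/I'] with [S/J']. Its image in [S/J'] is zero, so flatness
    makes it a finite combination of the defining relations of the tensor product; lifting these to
    [R[[S]]] gives elements of [G]. *)
Lemma flat_relation (u : fcomb R S) : (forall t, I (u t)) ->
  infsum (fun t => f (u t) * t) = 0 -> G u.
Proof.
move=> uI u0; have [_ _ I'r] := idealP I'; have [_ _ Jr] := idealP J'.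
have [_ Il Ir] := idealP I.
pose M := image_ideal I' I.
have /choice[liftI liftIP] : forall q : M, exists r, I r /\ val q = cls I' r.
  by move=> q; have [r] := image_idealP q; exists r.
have liftIE q : cls I' (liftI q) = val q by case: (liftIP q).
have /choice[liftF liftFP] : forall x : F, exists t, x = cls J' t.
  by move=> x; exact: cls_surj.
(* The representatives [liftI] and [liftF] are arbitrary and not additive; [rel_psi] shows that the
   resulting defects lie in [G]. *)
pose base (p : M * F) : zmodule FM := (fcomb_single (liftI p.1) (liftF p.2) : FM).
pose psi : {freeg (M * F) / int} -> zmodule FM := fglift base.
have psiB z z' : psi (z - z') = psi z - psi z' by exact: lift_is_additive.
have psi0 : psi 0 = 0 by rewrite -(subrr 0) psiB subrr.
have psiD z z' : psi (z + z') = psi z + psi z'.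
  rewrite -[in LHS](opprK z') psiB -[- z']sub0r psiB psi0.
  by rewrite sub0r opprK.
have psiU p : psi << p >> = base p by rewrite /psi liftU scale1r.
have rel_psi z : gen_subgroup (@tensor_rel A F M) z -> G (psi z).
  apply: (gen_subgroup_ind (T := [set z | G (psi z : FM)])) z.
    split=> [/=|z z' Gz Gz' /=]; last by rewrite psiB; exact: (subgroupB (A := G)).
    by rewrite psi0; exact: (subgroup0 G).
  move=> _ [m m' x|m x x'|m r x] /=; rewrite !psiB !psiU /base /=.
  - rewrite !singleB; apply: single_small; rewrite -addrA -opprD.
    by apply/cls_eq; rewrite clsD !liftIE raddfD.
  - set a := liftI _; set t := liftF _; set t1 := liftF x; set t2 := liftF x'.
    have -> : (fcomb_single a t : FM) - (fcomb_single a t1 : FM) -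
        (fcomb_single a t2 : FM) = a *: (unit1 t - unit1 t1 - unit1 t2).
      by rewrite !scalerBr -!single_scale.
    apply: flat_gens_scale; first by case: (liftIP m).
    rewrite !valueB !value_unit1 -addrA -opprD; apply/cls_eq.
    by rewrite clsD -!liftFP.
  - have [p ->] := cls_surj r.
    set a := liftI _; set b := liftI m; set t := liftF x; set t' := liftF _.
    apply: (@flat_gens_single a b p t t'); first by case: (liftIP m).
      by apply/cls_eq; rewrite -cls_mul !liftIE linearZ.
    by apply/cls_eq; rewrite -scaleF -!liftFP.
have [B BP] := null_fset (@OpenSubgroup R I' I'open) (coefP u).
pose mk t : M := ImageIdeal (image_ideal_cls I' (uI t)).
pose w : {freeg (M * F) / int} := \sum_(t <- B) << (mk t, (cls J' t : F)) >>.
(* Under the inclusion into [A], [w] becomes the tensor of 1 with the class of the sum over [B] of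
   [f (u t) * t]. The full sum is zero and the terms off [B] lie in [J'], so this class vanishes. *)
have /rel_psi Gw : gen_subgroup (@tensor_rel A F M) w.
  rewrite -[w]subr0; apply/cls_eq.
  apply: (Fflat (i := val : {linear M -> (A^c)^o})); first exact: val_inj.
  rewrite /tensor_map !quot_mapE raddf0 cls0 raddf_sum cls_sum.
  have tE t : tens (val (mk t)) (cls J' t : F) =
      tens (1 : (A^c)^o) ((cls J' (f (u t) * t)) : F).
    rewrite -scaleF -tensZ; congr tens.
    by rewrite -[RHS]/((1 : A) * cls I' (u t)) mul1r.
  transitivity (\sum_(t <- B) tens (1 : (A^c)^o) (cls J' (f (u t) * t) : F)).
    apply: eq_bigr => t _; rewrite -tE; congr cls.
    exact: (freeg_mapU (val : {linear M -> (A^c)^o}) (mk t) (cls J' t : F)).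
  rewrite tens_sumr -[RHS](tens0r F (1 : (A^c)^o)); congr tens.
  rewrite -(cls_sum J'); transitivity (cls J' 0); last exact: cls0.
  apply/esym/cls_eq; rewrite -[X in X - _]u0.
  apply: (infsum_approx (U := @OpenSubgroup S J' J'open)); first exact: null_sum.
  by move=> t /BP uI'; apply/Jr/(ext_closure_sub JE).
have psiw : psi w = \sum_(t <- B) base (mk t, (cls J' t : F)).
  rewrite /w (big_morph psi psiD psi0).
  by apply: eq_bigr => t _; exact: psiU.
(* [u - w'] has coefficients in [I'], and [w' - psi w] only changes representatives. *)
pose w' : FM := \sum_(t <- B) (fcomb_single (u t) t : FM).
rewrite -[u : FM](subrK w'); apply: subgroupD.
  apply: flat_gens_small => t; rewrite free_coefB free_coef_sum.
  have [tB|tB] := boolP (t \in B).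
    rewrite (bigD1_seq t) //= eqxx big1 ?addr0 ?subrr; first exact: (subgroup0 I').
    by move=> i /negPf; rewrite eq_sym => ->.
  rewrite big1_seq ?subr0; first exact: BP.
  by move=> i /andP[_ iB] /=; case: eqP => // ti; rewrite ti iB in tB.
rewrite -[w'](subrK (psi w : FM)); apply: subgroupD => //.
rewrite psiw -sumrB; apply: subgroup_sum => t _; rewrite /base /=.
set a := liftI _; set t' := liftF _.
apply: (@flat_gens_single (u t) a 1 t t'); first by case: (liftIP (mk t)).
  by rewrite mulr1; apply/cls_eq; rewrite liftIE.
by rewrite rmorph1 mul1r; apply/cls_eq; rewrite -liftFP.
Qed.

End FlatRelations.

Definition linear_of (R : pzRingType) (M N : lmodType R) (g : M -> N)
    (gl : linear g) : {linear M -> N} :=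
  HB.pack g (GRing.isLinear.Build R M N *:%R g gl).

Lemma contra_act_map0 (R : clinRingType) (P : contramodule R) (X : choiceType)
    (g : X -> P) (d : fcomb R X) :
  (forall x, g x = (0 : contra_mod P)) -> contra_act P (fcomb_map g d) = (0 : contra_mod P).
Proof.
move=> g0; have -> : g = (contra_act P) \o (fun=> fcomb_zero R P).
  by apply: funext => x; exact: g0.
rewrite fcomb_map_comp contra_assoc; congr contra_act; apply: fcomb_ext => p.
rewrite fcomb_join_map (infsum_fin (A := fset0)) ?big_seq_fset0 // => x _.
by rewrite mulr0.
Qed.

(** * The kernel of [push] *)

Section Kernel.
Variables (R S : clinRingType) (f : {rmorphism R -> S}).
Hypothesis fcont : continuous f.
Variables (I : nat -> ideal R) (J : nat -> ideal S).
Hypotheses (Ichain : ideal_chain I) (Jchain : ideal_chain J).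
Hypothesis JE : forall n, ideal_set (J n) = ext_closure f (ideal_set (I n)).
Hypothesis I0 : ideal_set (I 0) = setT.
Hypothesis Fflat : forall n,
  flat (restr_scalars (quotr_map (ext_closure_sub (JE n))) (quotr (J n))^o).

Variable X : choiceType.
Notation SX := (S * X)%type.
Let FM := contra_mod (free_contra R SX).

Definition embed (x : X) : contra_hom (free_contra R S) (free_contra R SX) :=
  free_map R (fun t => (t, x)).

Lemma embedE x (u : fcomb R S) t y :
  coef (embed x u : fcomb R SX) (t, y) = if y == x then u t else 0.
Proof.
rewrite /= (infsum1 (x0 := t)) => [|t' t't]; rewrite xpair_eqE.
  by rewrite eqxx eq_sym.
by rewrite (negPf t't).
Qed.

Lemma push_embed x (u : fcomb R S) y :
  coef (push fcont X (embed x u) : fcomb S X) y =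
  if y == x then value f u else 0.
Proof.
have nF := null_push fcont (@push_gen S X) (embed x u) y.
rewrite pushE (infsum_slice (x := y) nF) => [|t z zy]; last first.
  by rewrite /= eq_sym (negPf zy) mulr0.
have [<-|yx] := eqVneq y x.
  by congr infsum; apply: funext => t; rewrite embedE eqxx /= eqxx.
rewrite (infsum_fin (A := fset0)) ?big_seq_fset0 // => t _.
by rewrite embedE (negPf yx) rmorph0 mul0r.
Qed.

Lemma null_slice (c : fcomb R SX) x : null_family (fun t => c (t, x)).
Proof.
apply: fset_null => U; have [B BU] := null_fset U (coefP c).
exists (fst @` B)%fset => t tB; apply: BU; apply: contra tB => tB.
by apply/imfsetP; exists (t, x).
Qed.

Definition slice c x : fcomb R S := Fcomb (@null_slice c x).

Lemma value_slice (c : fcomb R SX) x :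
  value f (slice c x) = coef (push fcont X c : fcomb S X) x.
Proof.
rewrite pushE (infsum_slice (x := x)) => [||t z zx]; last 1 first.
- by rewrite /= eq_sym (negPf zx) mulr0.
- by congr infsum; apply: funext => t; rewrite /= eqxx.
- exact: null_push.
Qed.

Definition is_relation (z : fcomb R SX) : Prop :=
  (forall y, coef (push fcont X z : fcomb S X) y = 0) /\
  exists x, forall t y, y != x -> z (t, y) = 0.

(** The boolean predicate gives [Z] a choice structure, so that relations can index formal
    combinations. *)
Let Z := {z : fcomb R SX | `[< is_relation z >]}.
Let incl (z : Z) : fcomb R SX := sval z.

Lemma push_relations (d : fcomb R Z) y :
  coef (push fcont X (fcomb_join (fcomb_map incl d)) : fcomb S X) y = 0.
Proof.
rewrite (contra_homP (push fcont X)) -fcomb_map_comp.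
rewrite -[contra_act _ _]/(fcomb_join (fcomb_ring fcont
  (fcomb_map (push fcont X \o incl) d))).
rewrite fcomb_ring_map fcomb_join_map (infsum_fin (A := fset0)) ?big_seq_fset0 // => z _.
by have /asboolP[zP _] := svalP z; rewrite [X in _ * X](zP y) mulr0.
Qed.

Definition approx_relations n : set FM := [set c | exists2 d : fcomb R Z,
  forall z, I n (d z) &
  forall y, I n.+1 (coef c y - infsum (fun z => d z * incl z y))].

Lemma approx_relations_subgroup n : is_subgroup (approx_relations n).
Proof.
split.
  exists (fcomb_zero R Z) => [z|y]; first exact: (subgroup0 (I n)).
  rewrite free_coef0 (infsum_fin (A := fset0)) ?big_seq_fset0 ?subrr => [|z _].
    exact: (subgroup0 (I n.+1)).
  by rewrite mul0r.
move=> c c' [d dI dc] [d' dI' dc'].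
exists (fcomb_add d (fcomb_scale (-1) d')) => [z /=|y].
  by rewrite mulN1r; apply: (subgroupB (A := I n)); [exact: dI|exact: dI'].
have -> : infsum (fun z => fcomb_add d (fcomb_scale (-1) d') z * incl z y) =
    infsum (fun z => d z * incl z y) - infsum (fun z => d' z * incl z y).
  rewrite -infsumB; try exact: nullMr (coefP _).
  by congr infsum; apply: funext => z /=; rewrite mulN1r mulrBl.
rewrite free_coefB opprD addrACA -opprD.
by apply: (subgroupB (A := I n.+1)); [exact: dc|exact: dc'].
Qed.

(** A generator with coefficients in [I n.+1] is approximated by the zero combination; a generator
    [a *: u] is the relation [embed x u] taken with coefficient [a]. *)
Lemma embed_approx n x c :
  gen_subgroup (@flat_gens R S f (I n) (I n.+1)) c ->
  approx_relations n (embed x c).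
Proof.
have [T0 TB] := approx_relations_subgroup n.
pose E : {linear contra_mod (free_contra R S) -> FM} := forget_map (embed x).
move: c; apply: (gen_subgroup_ind
  (T := [set c : contra_mod (free_contra R S) | approx_relations n (E c)])).
  split=> [|a b Ta Tb].
    by change (approx_relations n (E 0)); rewrite raddf0.
  by change (approx_relations n (E (a - b))); rewrite raddfB; exact: TB.
move=> c [cI|[a [u [aI u0 ->]]]].
  change (approx_relations n (embed x c)).
  exists (fcomb_zero R Z) => [z|[t y]]; first exact: (subgroup0 (I n)).
  rewrite (infsum_fin (A := fset0)) ?big_seq_fset0 ?subr0 => [|z _]; last by rewrite mul0r.
  rewrite embedE; case: ifP => _; [exact: cI|exact: (subgroup0 (I n.+1))].
change (approx_relations n (E (a *: u))).
have uZ : `[< is_relation (embed x u) >].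
  apply/asboolP; split=> [y|]; first by rewrite push_embed u0; case: ifP.
  by exists x => t y yx; rewrite embedE (negPf yx).
exists (fcomb_single a (exist (fun z => `[< is_relation z >]) _ uZ : Z)) => [z /=|y].
  by case: ifP => _ //; exact: (subgroup0 (I n)).
rewrite infsum_delta linearZ.
rewrite free_coefZ subrr; exact: (subgroup0 (I n.+1)).
Qed.

(** Modulo [I n.+1], [c] is a finite sum of its slices over single [x]. Each slice has value zero
    and coefficients in [I n], so [flat_relation] applies to it. *)
Lemma kernel_approx n (c : fcomb R SX) : (forall z, I n (c z)) ->
  (forall y, coef (push fcont X c : fcomb S X) y = 0) -> approx_relations n c.
Proof.
move=> cI c0; have [A AI] := null_fset (chain_subgroup Ichain n.+1) (coefP c).
pose u := slice c.
have u0 x : value f (u x) = 0 by rewrite value_slice.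
have Tu x : approx_relations n (embed x (u x)).
  apply: embed_approx; apply: (flat_relation fcont (@Fflat n.+1)) => //.
  - exact: (chain_open Ichain).
  - exact: (chain_open Jchain).
  - move=> s Js.
    (* The spanning of [J n.+1] is [push_onto] for the one-term combination [s x], read on the slice
       at [x]. *)
    have [|d dI dE] := push_onto fcont Ichain Jchain JE (m := n.+1) (X := X)
      (c := fcomb_single s x).
      by move=> y /=; case: ifP => _ //; exact: (subgroup0 (J n.+1)).
    exists (slice d x) => [t|]; first exact: dI.
    by rewrite -[LHS]/(value f (slice d x)) value_slice dE /= eqxx.
  - by move=> t; exact: cI.
  - exact: u0.
pose T := Subgroup (approx_relations_subgroup n).
pose w : FM := \sum_(x <- (snd @` A)%fset) (embed x (u x) : FM).
rewrite -[c : FM](subrK w); apply: (subgroupD (A := T)); last first.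
  by apply: (subgroup_sum (A := T)) => x _; exact: Tu.
exists (fcomb_zero R Z) => [z|[t y]]; first exact: (subgroup0 (I n)).
rewrite (infsum_fin (A := fset0)) ?big_seq_fset0 ?subr0 => [|z _]; last by rewrite mul0r.
rewrite free_coefB free_coef_sum.
under eq_bigr => x _ do rewrite embedE.
have [yA|yA] := boolP (y \in (snd @` A)%fset).
  rewrite (bigD1_seq y) //= eqxx big1 ?addr0 ?subrr; first exact: (subgroup0 (I n.+1)).
  by move=> x /negPf; rewrite eq_sym => ->.
rewrite big1_seq ?subr0.
  by apply: AI; apply: contra yA => tA; apply/imfsetP; exists (t, y).
by move=> x /andP[_ xA] /=; case: eqP => // yx; rewrite yx xA in yA.
Qed.

Hypothesis Rff : fully_faithful (forget_functor R).
Variables (P : contramodule R).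
Variable h : X -> {linear restr_scalars f S^o -> contra_mod P}.

Definition gen_value (z : SX) : P := h z.2 (z.1 : S).

Lemma coordinate_linear x :
  linear (fun c : contra_mod (sharp_free fcont X) => h x (coef (c : fcomb S X) x)).
Proof. by move=> a c d; rewrite sharp_coefD sharp_coefZ linearP. Qed.

(* Full faithfulness makes the [R]-linear map [c |-> h x (c x)] a contramodule
   morphism [S[[X]] -> P]; it agrees with [gen_value] on the generators over [x]. *)
Lemma relation_killed z : is_relation z ->
  contra_ext gen_value z = (0 : contra_mod P).
Proof.
move=> [z0 [x zx]].
pose H := linear_of (coordinate_linear x).
transitivity (H (push fcont X z)); last first.
  by rewrite -[H _]/(h x (coef (push fcont X z : fcomb S X) x)) z0 raddf0.
rewrite -[push fcont X z]/(contra_act (sharp_free fcont X) (fcomb_map (@push_gen S X) z)).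
rewrite contra_linear // -fcomb_map_comp; congr contra_act; apply: eq_fcomb_map.
move=> [t y] /=; have [->|yx] := eqVneq y x; last by move=> /eqP[]; exact: zx.
by [].
Qed.

(** Successive approximation over [R] itself, with the relations as generators, writes [c] as a
    zero-convergent combination of relations over single [x]. The morphism [contra_ext gen_value]
    kills each of them. *)
Lemma kernel_killed (c : fcomb R SX) :
  (forall y, coef (push fcont X c : fcomb S X) y = 0) ->
  contra_ext gen_value c = (0 : contra_mod P).
Proof.
move=> c0.
have idcont : continuous (idfun : R -> R) by move=> x; exact: cvg_id.
have [||//|d _ cE] := @successive_approximation R R idfun idcont I Ichain Z _ incl
  (fun n c => (forall z, I n (c z)) /\
     forall y, coef (push fcont X c : fcomb S X) y = 0) _ _ c.
- move=> U; have [k kU] := chain_base Ichain U; exists k => n c' kn [c'I _] z.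
  exact/kU/(chain_le Ichain kn)/c'I.
- move=> n c' [c'I c'0]; have [d dI dc] := kernel_approx c'I c'0.
  exists d => //; pose b := fcomb_join (fcomb_map incl d).
  have bE y : b y = infsum (fun z => idfun (d z) * incl z y) by exact: fcomb_join_map.
  exists ((c' : FM) - (b : FM)).
    split=> [z|y]; first by rewrite free_coefB bE; exact: dc.
    have E := raddfB (forget_map (push fcont X)) (c' : FM) (b : FM).
    change (coef (forget_map (push fcont X) ((c' : FM) - (b : FM)) : fcomb S X) y = 0).
    rewrite E sharp_coefB.
    have -> : coef (forget_map (push fcont X) (c' : FM) : fcomb S X) y = 0 by exact: c'0.
    have -> : coef (forget_map (push fcont X) (b : FM) : fcomb S X) y = 0.
      exact: push_relations.
    by rewrite subrr.
  by move=> y; rewrite free_coefB bE.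
- by split=> // z; rewrite -[I _ _]/(ideal_set _ _) I0.
have -> : c = fcomb_join (fcomb_map incl d).
  by apply: fcomb_ext => y; rewrite fcomb_join_map cE.
rewrite (contra_homP (contra_ext gen_value)) -fcomb_map_comp.
apply: contra_act_map0 => z; apply: relation_killed.
exact/asboolP/(svalP z).
Qed.

End Kernel.

(** * Linear maps out of [S[[X]]] *)

Section Extension.
Variables (R S : clinRingType) (f : {rmorphism R -> S}).
Hypotheses (fcont : continuous f) (Rcount : countable_nbhs_base0 R).
Hypothesis Rff : fully_faithful (forget_functor R).
Implicit Types X Y : choiceType.

Local Notation L X := (contra_mod (sharp_free fcont X)).

Lemma taut_free_ext X (P : contramodule R) (g h : {linear L X -> contra_mod P}) :
  strongly_right_taut f ->
  (forall t x, g (fcomb_single t x) = h (fcomb_single t x)) -> g =1 h.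
Proof.
move=> ftaut; have [I [J [cI cJ JE I0]]] := taut_chain Rcount fcont ftaut.
exact: (sharp_free_ext cI cJ JE).
Qed.

Hypothesis fproflat : left_proflat f.

(** The morphism [contra_ext (gen_value h)] factors through the surjection [push]: by
    [kernel_killed] its value at a preimage of [c] does not depend on the choice [s c]. *)
Lemma proflat_free_lift X (P : contramodule R)
    (h : X -> {linear restr_scalars f S^o -> contra_mod P}) :
  exists e : {linear L X -> contra_mod P},
    forall t x, e (fcomb_single t x) = h x t.
Proof.
have [_ ftaut fflat] := fproflat.
have [I [J [cI cJ JE I0]]] := taut_chain Rcount fcont ftaut.
have Fflat n := fflat (I n) (J n) (JE n) (chain_open cI n) (chain_open cJ n).
have /choice[s sP] : forall c : L X, exists d : contra_mod (free_contra R (S * X)%type),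
    push fcont X d = c by move=> c; have [d] := push_surj fcont cI cJ JE I0 c; exists d.
pose G : {linear contra_mod (free_contra R (S * X)%type) -> contra_mod P} :=
  forget_map (contra_ext (gen_value h)).
pose Phi : {linear contra_mod (free_contra R (S * X)%type) -> L X} :=
  forget_map (push fcont X).
pose e (c : L X) : contra_mod P := G (s c).
have GE c d : Phi d = c -> e c = G d.
  move=> dc; apply/eqP; rewrite -subr_eq0 -raddfB; apply/eqP.
  refine (kernel_killed (fcont := fcont) cI cJ I0 Fflat Rff h (c := s c - d) _) => y.
  have -> : push fcont X (s c - d) = Phi (s c) - Phi d by rewrite -raddfB.
  by rewrite sharp_coefB dc -[Phi _]/(push fcont X (s c)) sP subrr.
have el : linear e.
  move=> a c c'; rewrite (GE _ (a *: s c + s c')).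
    by rewrite linearP.
  have PhiE b : Phi (s b) = b by exact: sP.
  by rewrite linearP !PhiE.
exists (linear_of el) => t x.
rewrite -[LHS]/(e _) (GE _ (fcomb_single 1 (t, x))).
  rewrite -[LHS]/(contra_act P (fcomb_map _ (fcomb_unit R _))).
  by rewrite fcomb_map_single contra_unit.
rewrite -[LHS]/(contra_act _ (fcomb_map _ (fcomb_unit R _))) fcomb_map_single.
exact: contra_unit.
Qed.

End Extension.

(** * The [R]-contramodule [Hom_R(S, P)] *)

Section FcombScale.
Variable S : clinRingType.

Lemma fcomb_scale_single (X : choiceType) (s a : S) (x : X) :
  fcomb_scale s (fcomb_single a x) = fcomb_single (s * a) x.
Proof. by apply: fcomb_ext => y /=; case: ifP; rewrite ?mulr0. Qed.

Lemma fcomb_scale_map (X Y : choiceType) (g : X -> Y) (s : S) (c : fcomb S X) :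
  fcomb_scale s (fcomb_map g c) = fcomb_map g (fcomb_scale s c).
Proof.
apply: fcomb_ext => y; rewrite fcomb_mapE /= -[infsum _]/(fcomb_map g c y).
rewrite fcomb_mapE -infsumMl; last exact: nullMr (coefP c).
by congr infsum; apply: funext => x; rewrite mulrA.
Qed.

Lemma fcomb_scale_join (X : choiceType) (s : S) (c : fcomb S (fcomb S X)) :
  fcomb_scale s (fcomb_join c) = fcomb_join (fcomb_scale s c).
Proof.
apply: fcomb_ext => x /=; rewrite -infsumMl; last exact: nullMr (coefP c).
by congr infsum; apply: funext => a; rewrite mulrA.
Qed.

End FcombScale.

Section HomContramodule.
Variables (R S : clinRingType) (f : {rmorphism R -> S}).
Hypotheses (fcont : continuous f) (Rcount : countable_nbhs_base0 R).
Hypothesis Rff : fully_faithful (forget_functor R).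
Hypothesis ftaut : strongly_right_taut f.
Implicit Types X Y : choiceType.

Local Notation L X := (contra_mod (sharp_free fcont X)).
Local Notation SR := (restr_scalars f S^o).

(** The Kleisli extension of [v], typed as an [R]-linear map so that [taut_free_ext] can compare
    composites with it. *)
Definition free_bind X Y (v : X -> fcomb S Y) : {linear L X -> L Y} :=
  forget_map (sharp_fmap fcont (contra_ext (P := free_contra S Y) v)).

Definition free_relabel X Y (g : X -> Y) : {linear L X -> L Y} :=
  forget_map (sharp_fmap fcont (free_map S g)).

Lemma free_bind_single X Y (v : X -> fcomb S Y) s x :
  free_bind v (fcomb_single s x) = fcomb_scale s (v x).
Proof. by rewrite -[LHS]/(fcomb_join (fcomb_map _ _)) fcomb_map_single fcomb_join_single. Qed.

Lemma free_relabel_single X Y (g : X -> Y) s x :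
  free_relabel g (fcomb_single s x) = fcomb_single s (g x).
Proof. exact: fcomb_map_single. Qed.

Lemma sharp_fcomb_add X (c d : fcomb S X) : fcomb_add c d = ((c : L X) + (d : L X)).
Proof. by apply: fcomb_ext => x; rewrite sharp_coefD. Qed.

Lemma orbit_linear X (c : fcomb S X) :
  linear (fun t : SR => fcomb_scale (t : S) c : L X).
Proof.
move=> a t t'; apply: fcomb_ext => x; rewrite sharp_coefD sharp_coefZ /=.
by rewrite -[_ *: t]/(f a * (t : S)) mulrDl mulrA.
Qed.

Variable P : contramodule R.

Definition hom_carrier : Type := {linear SR -> contra_mod P}.
HB.instance Definition _ := gen_eqMixin hom_carrier.
HB.instance Definition _ := gen_choiceMixin hom_carrier.

Definition hom_eval (h : hom_carrier) : {linear SR -> contra_mod P} := h.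

Variable E : {linear L hom_carrier -> contra_mod P}.
Hypothesis EP : forall t h, E (fcomb_single t h) = hom_eval h t.

(* The action is [(sum_h c_h h)(t) = sum_h h (t f(c_h))]; the right-hand side
   makes sense because [E] extends [t h |-> h t] from finite to infinite sums. *)
Definition hom_act (c : fcomb R hom_carrier) : hom_carrier :=
  E \o linear_of (orbit_linear (fcomb_ring fcont c)).

Lemma hom_actE c t :
  hom_eval (hom_act c) t = E (fcomb_scale (t : S) (fcomb_ring fcont c)).
Proof. by []. Qed.

Lemma hom_eval_ext h k : hom_eval h =1 hom_eval k -> h = k.
Proof. exact: linear_ext. Qed.

Lemma hom_unit h : hom_act (fcomb_unit R h) = h.
Proof.
apply: hom_eval_ext => t; rewrite hom_actE fcomb_ring_single fcomb_scale_single.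
by rewrite rmorph1 mulr1 EP.
Qed.

(** At each [t] the two sides are values of two [R]-linear maps at the same element, so it suffices
    to compare these on one-term combinations. *)
Lemma hom_assoc c : hom_act (fcomb_map hom_act c) = hom_act (fcomb_join c).
Proof.
apply: hom_eval_ext => t; rewrite !hom_actE fcomb_ring_map fcomb_ring_join.
rewrite fcomb_scale_map fcomb_scale_join fcomb_scale_map.
apply: (taut_free_ext Rcount Rff
  (g := E \o free_relabel hom_act)
  (h := E \o free_bind (@fcomb_ring _ _ _ fcont _))) => // s a.
rewrite -[LHS]/(E (free_relabel hom_act _)) -[RHS]/(E (free_bind _ _)).
by rewrite free_relabel_single free_bind_single EP hom_actE.
Qed.

Definition hom_contra := Contramodule hom_unit hom_assoc.

Lemma hom_evalD (h k : contra_mod hom_contra) t :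
  hom_eval (h + k) t = hom_eval h t + hom_eval k t.
Proof.
rewrite -[h + k]/(hom_act (fcomb_add (fcomb_single 1 (h : hom_carrier))
  (fcomb_single 1 (k : hom_carrier)))).
rewrite hom_actE fcomb_ring_add !fcomb_ring_single rmorph1.
have -> : fcomb_scale (t : S) (fcomb_add (fcomb_single 1 (h : hom_carrier))
      (fcomb_single 1 (k : hom_carrier))) =
    fcomb_add (fcomb_single (t : S) (h : hom_carrier))
      (fcomb_single (t : S) (k : hom_carrier)).
  rewrite -[in RHS](mulr1 (t : S)) -!fcomb_scale_single.
  by apply: fcomb_ext => x; exact: mulrDr.
by rewrite sharp_fcomb_add -!EP; exact: raddfD.
Qed.

(** [R] acts on [Hom_R(S, P)] through right multiplication on [S]. *)
Lemma hom_evalZ a (h : contra_mod hom_contra) t :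
  hom_eval (a *: h) t = hom_eval h ((t : S) * f a).
Proof.
rewrite -[a *: h]/(hom_act (fcomb_single a (h : hom_carrier))).
by rewrite hom_actE fcomb_ring_single fcomb_scale_single EP.
Qed.

(** * The [S]-contramodule structure from a compatible [S]-module structure *)

Variables (M : lmodType S) (phi : {linear contra_mod P -> restr_scalars f M})
  (psi : {linear restr_scalars f M -> contra_mod P}).
Hypotheses (phiK : cancel phi psi) (psiK : cancel psi phi).

Definition smul (t : S) (p : P) : P := psi (t *: (phi p : M)).

Lemma smulA s t p : smul s (smul t p) = smul (s * t) p.
Proof. by rewrite /smul psiK scalerA. Qed.

Lemma smul1 p : smul 1 p = p.
Proof. by rewrite /smul scale1r phiK. Qed.

Lemma smul_linear p : linear (fun t : SR => smul (t : S) p : contra_mod P).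
Proof.
move=> a t t'; rewrite /smul -[_ *: t]/(f a * (t : S)).
by rewrite scalerDl -scalerA -linearP.
Qed.

Definition orbit_map (p : P) : hom_carrier := linear_of (smul_linear p).

Lemma orbit_map_linear :
  linear (orbit_map : contra_mod P -> contra_mod hom_contra).
Proof.
move=> a p q; apply: hom_eval_ext => t; rewrite hom_evalD hom_evalZ.
rewrite -[LHS]/(smul t _) -[RHS]/((smul (t * f a) p : contra_mod P) + smul t q).
rewrite /smul linearP -raddfD; congr (psi _).
rewrite -[LHS]/((t : S) *: (f a *: (phi p : M) + (phi q : M))).
by rewrite scalerDr scalerA.
Qed.

(** Replacing each [p] by its orbit map and evaluating with [E] extends [t p |-> smul t p] to
    zero-convergent combinations. *)
Definition scalar_act : {linear L P -> contra_mod P} := E \o free_relabel orbit_map.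

Lemma scalar_act_single t p : scalar_act (fcomb_single t p) = smul t p.
Proof. by rewrite -[LHS]/(E (free_relabel orbit_map _)) free_relabel_single EP. Qed.

(** The orbit map is [R]-linear between contramodules, hence a morphism by full faithfulness; the
    claim is this fact evaluated at [t]. *)
Lemma smul_act t (c : fcomb R P) :
  smul t (contra_act P c) = scalar_act (fcomb_scale t (fcomb_ring fcont c)).
Proof.
rewrite -[LHS]/(hom_eval (orbit_map (contra_act P c)) t).
have -> : orbit_map (contra_act P c) = hom_act (fcomb_map orbit_map c).
  exact: (contra_linear (linear_of orbit_map_linear) Rff c).
by rewrite hom_actE fcomb_ring_map fcomb_scale_map.
Qed.

(** By surjectivity of [push], [b] is an infinite [R]-combination of terms [u p], and [smul_act]
    carries [t] through it. Two [R]-linear maps on [S[[S * P]]] remain, which agree on terms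
    [s (u, p)] by [smulA]. *)
Lemma scalar_actZ t (b : fcomb S P) :
  scalar_act (fcomb_scale t b) = smul t (scalar_act b).
Proof.
have [I [J [cI cJ JE I0]]] := taut_chain Rcount fcont ftaut.
have [d <-] := push_surj fcont cI cJ JE I0 b.
rewrite -[push fcont P d]/(contra_act (sharp_free fcont P) (fcomb_map (@push_gen S P) d)).
rewrite contra_linear // -fcomb_map_comp smul_act fcomb_ring_map fcomb_scale_map.
rewrite -[contra_act _ _]/(fcomb_join (fcomb_ring fcont (fcomb_map (@push_gen S P) d))).
rewrite fcomb_ring_map fcomb_scale_join fcomb_scale_map.
pose g : {linear L (S * P)%type -> contra_mod P} := scalar_act \o free_bind (@push_gen S P).
pose h : {linear L (S * P)%type -> contra_mod P} :=
  scalar_act \o @free_relabel (S * P)%type P (scalar_act \o @push_gen S P).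
suff gh : g =1 h by exact: (gh (fcomb_scale t (fcomb_ring fcont d))).
apply: (taut_free_ext Rcount Rff) => // s [u p].
rewrite -[LHS]/(scalar_act (free_bind _ _)) -[RHS]/(scalar_act (free_relabel _ _)).
rewrite free_relabel_single free_bind_single fcomb_scale_single !scalar_act_single.
rewrite -smulA; congr smul; exact/esym/scalar_act_single.
Qed.

Lemma scalar_act_unit p : (scalar_act : fcomb S P -> P) (fcomb_unit S p) = p.
Proof. by rewrite scalar_act_single smul1. Qed.

Lemma scalar_act_assoc (c : fcomb S (fcomb S P)) :
  (scalar_act : fcomb S P -> P) (fcomb_map (scalar_act : fcomb S P -> P) c) =
  scalar_act (fcomb_join c).
Proof.
rewrite -[in RHS](fcomb_map_id c).
pose g : {linear L (fcomb S P) -> contra_mod P} :=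
  scalar_act \o @free_relabel (fcomb S P) P scalar_act.
pose h : {linear L (fcomb S P) -> contra_mod P} :=
  scalar_act \o @free_bind (fcomb S P) P id.
suff gh : g =1 h by exact: (gh c).
apply: (taut_free_ext Rcount Rff) => // s b.
rewrite -[LHS]/(scalar_act (free_relabel _ _)) -[RHS]/(scalar_act (free_bind _ _)).
by rewrite free_relabel_single free_bind_single scalar_act_single scalar_actZ.
Qed.

Definition scalar_contra : contramodule S :=
  Contramodule scalar_act_unit scalar_act_assoc.

Lemma scalar_contra_linear : linear (phi : contra_mod scalar_contra -> M).
Proof.
have Z a (p : contra_mod scalar_contra) : a *: p = smul a p :> P.
  exact: scalar_act_single.
have D (p q : contra_mod scalar_contra) :
    p + q = ((p : contra_mod P) + (q : contra_mod P)) :> P.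
  rewrite -[LHS]/(scalar_act
    (fcomb_add (fcomb_single 1 (p : P)) (fcomb_single 1 (q : P)))).
  rewrite sharp_fcomb_add -[in RHS](smul1 p) -[in RHS](smul1 q) -!scalar_act_single.
  exact: (raddfD scalar_act (fcomb_single 1 (p : P) : L P)
    (fcomb_single 1 (q : P) : L P)).
move=> a p q; rewrite D raddfD Z.
congr (_ + _); exact: (psiK (a *: (phi p : M))).
Qed.

End HomContramodule.

(** * The pseudopullback *)

Lemma fully_faithfulP (C D : category) (F : functor C D) :
  fully_faithful F <->
  (forall A B (h k : Defs.hom A B), fmor F h = fmor F k -> h = k) /\
  (forall A B (g : Defs.hom (F A) (F B)), exists h : Defs.hom A B, fmor F h = g).
Proof.
split=> [ff|[inj surj] A B].
  split=> [A B h k|A B g]; first by have /bij_inj := ff A B; apply.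
  by have [g' _ gK] := ff A B; exists (g' g).
have /choice[g gK] := surj A B.
by exists g => // h; apply: inj.
Qed.

Lemma lift_iso (C D : category) (F : functor C D) (A B : C) (i : iso (F A) (F B)) :
  fully_faithful F -> exists j : iso A B, fmor F (iso_hom j) = iso_hom i.
Proof.
move=> /fully_faithfulP[inj surj].
have [h hE] := surj _ _ (iso_hom i); have [k kE] := surj _ _ (iso_inv i).
have kh : compm k h = idm A.
  by apply: inj; rewrite fmor_comp hE kE iso_homK fmor1.
have hk : compm h k = idm B.
  by apply: inj; rewrite fmor_comp hE kE iso_invK fmor1.
by exists (Iso kh hk).
Qed.

Lemma is_equivalence_criterion (C D : category) (F : functor C D) :
  fully_faithful F -> (forall Y : D, exists X : C, inhabited (iso (F X) Y)) ->
  is_equivalence F.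
Proof.
move=> ff ess; have [inj surj] := (fully_faithfulP F).1 ff.
have pre (A B : C) : {p : Defs.hom (F A) (F B) -> Defs.hom A B |
    forall g, fmor F (p g) = g} by have [p pE] := choice (surj A B); exists p.
pose p A B := sval (pre A B).
have pE A B g : fmor F (p A B g) = g by exact: (svalP (pre A B)).
have obs (Y : D) : {X : C & inhabited (iso (F X) Y)} by exact: cid (ess Y).
pose g Y := projT1 (obs Y).
have ex_eps Y : {e : iso (F (g Y)) Y | True}.
  by apply: cid; have [e] := projT2 (obs Y); exists e.
pose eps Y := sval (ex_eps Y).
pose gm (Y Y' : D) (k : Defs.hom Y Y') : Defs.hom (g Y) (g Y') :=
  p _ _ (compm (iso_inv (eps Y')) (compm k (iso_hom (eps Y)))).
have gm1 Y : gm Y Y (idm Y) = idm (g Y).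
  by apply: inj; rewrite pE comp1m iso_homK fmor1.
have gm_comp Y Y' Y'' (h : Defs.hom Y' Y'') (k : Defs.hom Y Y') :
    gm Y Y'' (compm h k) = compm (gm Y' Y'' h) (gm Y Y' k).
  apply: inj; rewrite fmor_comp !pE -!Defs.compA; do 2 congr compm.
  by rewrite !Defs.compA iso_invK comp1m.
pose G := Functor gm1 gm_comp.
exists G; split.
  pose jX X := cid (lift_iso (eps (F X)) ff).
  pose j X : iso (g (F X)) X := sval (jX X).
  have jE X : fmor F (iso_hom (j X)) = iso_hom (eps (F X)) by exact: (svalP (jX X)).
  have jnat (A B : C) (h : Defs.hom A B) :
      compm (iso_hom (j B)) (fmor (comp_functor G F) h) =
      compm (fmor (id_functor C) h) (iso_hom (j A)).
    apply: inj; rewrite !fmor_comp !jE pE !Defs.compA iso_invK comp1m.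
    by [].
  by constructor; exact: (@NatIso C C (comp_functor G F) (id_functor C) j jnat).
have enat (A B : D) (h : Defs.hom A B) :
    compm (iso_hom (eps B)) (fmor (comp_functor F G) h) =
    compm (fmor (id_functor D) h) (iso_hom (eps A)).
  by rewrite /= pE !Defs.compA iso_invK comp1m.
by constructor; exact: (@NatIso D D (comp_functor F G) (id_functor D) eps enat).
Qed.

(** As [F] is fully faithful, the right component of a morphism of triples determines the left one,
    and an isomorphism on the right induces one on the left. *)
Lemma pseudopullback_criterion (A B C D : category) (F : functor A C)
    (G : functor B C) (H : functor D A) (K : functor D B)
    (alpha : nat_iso (comp_functor F H) (comp_functor G K)) :
  fully_faithful F -> fully_faithful K ->
  (forall P : pspb_obj F G, exists X : D, inhabited (iso (K X) (pspb_right P))) ->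
  is_pseudopullback alpha.
Proof.
move=> Fff Kff ess; have [Finj Fsurj] := (fully_faithfulP F).1 Fff.
have [Kinj Ksurj] := (fully_faithfulP K).1 Kff.
have left_det (P Q : pspb_obj F G) (h k : pspb_hom P Q) :
    pspb_hom_right h = pspb_hom_right k -> h = k.
  move=> hk; apply: pspb_hom_ext => //; apply: Finj.
  rewrite -[LHS]comp1m -[RHS]comp1m -(iso_homK (pspb_iso Q)) -!Defs.compA.
  by rewrite !pspb_homP hk.
apply: is_equivalence_criterion.
  apply/fully_faithfulP; split=> [X Y h k hk|X Y g].
    by apply: Kinj; exact: (congr1 (@pspb_hom_right _ _ _ _ _ _ _) hk).
  have [h hE] := Ksurj _ _ (pspb_hom_right g).
  by exists h; apply: left_det.
move=> P; have [X [b]] := ess P; exists X.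
have bG : compm (fmor G (iso_inv b)) (fmor G (iso_hom b)) = idm _.
  by rewrite -fmor_comp iso_homK fmor1.
have Gb : compm (fmor G (iso_hom b)) (fmor G (iso_inv b)) = idm _.
  by rewrite -fmor_comp iso_invK fmor1.
pose phi := pspb_iso P.
(* [u] and [v] are [b] and its inverse carried to the images under [F] by the gluing
   isomorphisms. *)
pose u : Defs.hom (F (H X)) (F (pspb_left P)) :=
  compm (iso_inv phi) (compm (fmor G (iso_hom b)) (iso_hom (alpha X))).
pose v : Defs.hom (F (pspb_left P)) (F (H X)) :=
  compm (iso_inv (alpha X)) (compm (fmor G (iso_inv b)) (iso_hom phi)).
have uv : compm u v = idm _.
  rewrite /u /v -!Defs.compA (Defs.compA (iso_hom (alpha X))) iso_invK comp1m.
  by rewrite (Defs.compA (fmor G (iso_hom b))) Gb comp1m iso_homK.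
have vu : compm v u = idm _.
  rewrite /u /v -!Defs.compA (Defs.compA (iso_hom phi)) iso_invK comp1m.
  by rewrite (Defs.compA (fmor G (iso_inv b))) bG comp1m iso_homK.
have [j jE] := lift_iso (Iso vu uv) Fff.
have jvE : fmor F (iso_inv j) = v.
  rewrite -[LHS]compm1 -uv Defs.compA -[u]jE -fmor_comp iso_homK fmor1.
  exact: comp1m.
have hP : compm (iso_hom phi) (fmor F (iso_hom j)) =
    compm (fmor G (iso_hom b)) (iso_hom (alpha X)).
  by rewrite jE (Defs.compA (iso_hom phi) (iso_inv phi)) iso_invK comp1m.
have kP : compm (iso_hom (alpha X)) (fmor F (iso_inv j)) =
    compm (fmor G (iso_inv b)) (iso_hom phi).
  by rewrite jvE /v Defs.compA iso_invK comp1m.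
pose h : pspb_hom (comparison_obj alpha X) P :=
  @PspbHom _ _ _ F G (comparison_obj alpha X) P _ _ hP.
pose k : pspb_hom P (comparison_obj alpha X) :=
  @PspbHom _ _ _ F G P (comparison_obj alpha X) _ _ kP.
constructor; apply: (@Iso (pseudopullback F G) (comparison_obj alpha X) P h k).
  by apply: left_det; exact: iso_homK.
by apply: left_det; exact: iso_invK.
Qed.

(** For fullness, an [S]-linear [g] gives two [R]-linear maps from [S[[A]]] to [B]: act and then
    apply [g], or apply [g] to the terms and then act. They agree on terms [t a] by [S]-linearity,
    hence everywhere. *)
Lemma forget_fully_faithful (R S : clinRingType) (f : {rmorphism R -> S}) :
  continuous f -> countable_nbhs_base0 R -> strongly_right_taut f ->
  fully_faithful (forget_functor R) -> fully_faithful (forget_functor S).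
Proof.
move=> fcont Rcount ftaut Rff; apply/fully_faithfulP; split.
  move=> A B h k hk; apply: contra_hom_ext => a.
  exact: (congr1 (fun g : {linear contra_mod A -> contra_mod B} => g a) hk).
move=> A B g; pose gs : {linear contra_mod A -> contra_mod B} := g.
pose gR : {linear contra_mod (sharp_fobj fcont A) -> contra_mod (sharp_fobj fcont B)} :=
  @square_map_inv R S f fcont B \o (@restr_map R S f _ _ gs \o @square_map R S f fcont A).
have homP c : (gs : A -> B) (contra_act A c) = contra_act B (fcomb_map (gs : A -> B) c).
  pose e1 : {linear contra_mod (sharp_free fcont A) -> contra_mod (sharp_fobj fcont B)} :=
    gR \o forget_map (sharp_fmap fcont (contra_ext (P := A) id)).
  pose e2 : {linear contra_mod (sharp_free fcont A) -> contra_mod (sharp_fobj fcont B)} :=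
    forget_map (sharp_fmap fcont (contra_ext (P := B) (gs : A -> B))).
  suff e12 : e1 =1 e2 by rewrite -[in LHS](fcomb_map_id c); exact: (e12 c).
  apply: (taut_free_ext Rcount Rff) => // t a.
  rewrite -[LHS]/(gs (contra_ext (P := A) id _)) -[RHS]/(contra_ext (P := B) _ _).
  rewrite !contra_ext_single.
  exact: (linearZZ gs).
by exists (ContraHom homP); exact: linear_ext.
Qed.

Lemma scalar_contra_exists (R S : clinRingType) (f : {rmorphism R -> S})
    (P : pspb_obj (forget_functor R) (restr_functor f)) :
  continuous f -> countable_nbhs_base0 R -> left_proflat f ->
  fully_faithful (forget_functor R) ->
  exists Q : Contra S, inhabited (iso (forget_functor S Q) (pspb_right P)).
Proof.
case: P => A M i /= fcont Rcount fproflat Rff.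
pose phi : {linear contra_mod A -> restr_scalars f M} := iso_hom i.
pose psi : {linear restr_scalars f M -> contra_mod A} := iso_inv i.
have phiK : cancel phi psi.
  move=> p; exact: (congr1 (fun g : {linear contra_mod A -> contra_mod A} => g p)
    (iso_homK i)).
have psiK : cancel psi phi.
  move=> p; exact: (congr1
    (fun g : {linear restr_scalars f M -> restr_scalars f M} => g p) (iso_invK i)).
have [_ ftaut _] := fproflat.
(* The index set is [Hom_R(S, A)] itself, each map serving as its own component. *)
have [E EP] := proflat_free_lift fcont Rcount Rff fproflat (@hom_eval R S f A).
pose Q := scalar_contra Rcount Rff ftaut EP phiK psiK.
have gl : linear (phi : contra_mod Q -> M) by exact: scalar_contra_linear.
pose g : {linear contra_mod Q -> M} := linear_of gl.
have kl : linear (psi : M -> contra_mod Q).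
  move=> a x y; apply: (can_inj (phiK : cancel g psi)).
  rewrite [RHS]linearP; transitivity (a *: x + y); first exact: psiK.
  by congr (_ *: _ + _); exact/esym/psiK.
exists Q; constructor.
apply: (@Iso (Mod S) (contra_mod Q) M g (linear_of kl : {linear _ -> _})).
  by apply: linear_ext => p; exact: phiK.
by apply: linear_ext => x; exact: psiK.
Qed.

Theorem theorem9p5 (R S : clinRingType)
    (R_countable : countable_nbhs_base0 R) (S_countable : countable_nbhs_base0 S)
    (f : {rmorphism R -> S}) (f_continuous : continuous f)
    (f_proflat : left_proflat f)
    (R_ff : fully_faithful (forget_functor R)) :
  is_pseudopullback
    (F := forget_functor R) (G := restr_functor f)
    (H := sharp_functor f_continuous) (K := forget_functor S)
    (square_iso f_continuous) /\
  fully_faithful (forget_functor S) /\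
  fully_faithful (forget_functor R).
Proof.
have [_ f_taut _] := f_proflat.
have S_ff := forget_fully_faithful f_continuous R_countable f_taut R_ff.
split; last by split.
apply: pseudopullback_criterion => // P.
exact: scalar_contra_exists.
Qed.
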